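(* Let $t_0<t_1$, $0<\alpha\le 1$, $\beta>0$, let $L=L(t,x,y)$ be a real-valued function of $(t,x,y)\in[t_0,t_1]\times\mathbb{R}^n\times\mathbb{R}^n$ and $l:\mathbb{R}^n\times\mathbb{R}^n\to\mathbb{R}$, $l=l(x_0,x_1)$. Let $x^0$ deliver a weak local minimum in the fractional Bolza problem (without constraints) $$(PB)\qquad B(x(\cdot))=\int_{t_0}^{t_1}(t_1-t)^{\beta-1}L\big(t,x(t),({}^{c}D_{t_0+}^{\alpha}x)(t)\big)\,dt+l(x(t_0),x(t_1))$$ in the space $C^{\alpha}([t_0,t_1],\mathbb{R}^n)$. Assume that $L,L_x,L_y$ are continuous in some neighborhood of the graph $\{(t,x^0(t),({}^{c}D_{t_0+}^{\alpha}x^0)(t)) : t\in[t_0,t_1]\}$ and that $l$ is continuously differentiable in a neighborhood of the point $(x^0(t_0),x^0(t_1))$. Write $L_x(t)=L_x(t,x^0(t),({}^{c}D_{t_0+}^{\alpha}x^0)(t))$, $L_y(t)=L_y(t,x^0(t),({}^{c}D_{t_0+}^{\alpha}x^0)(t))$, $b(t)=(t_1-t)^{\beta-1}L_x(t)$, and let $l_{x_0},l_{x_1}$ be the gradients of $l$ in its first and second argument at $(x^0(t_0),x^0(t_1))$. Then: 1) if $0<\alpha<\beta$, then $$(t_1-t)^{1-\alpha}(I_{t_1-}^{\alpha}b)(t)+(t_1-t)^{\beta-\alpha}L_y(t)=0,\quad t\in[t_0,t_1],$$ $$\int_{t_0}^{t_1}(t_1-t)^{\beta-1}L_x(t)\,dt+l_{x_0}=0,\qquad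 l_{x_1}=0;$$ 2) if $0<\beta\le\alpha\le1$, then $$(t_1-t)^{1-\beta}(I_{t_1-}^{\alpha}b)(t)+L_y(t)+l_{x_1}\frac{1}{\Gamma(\alpha)}(t_1-t)^{\alpha-\beta}=0,\quad t\in[t_0,t_1],$$ $$\int_{t_0}^{t_1}(t_1-t)^{\beta-1}L_x(t)\,dt+l_{x_0}+l_{x_1}=0.$$
   Context: For $\alpha>0$: $(I_{t_0+}^{\alpha}\varphi)(t)=\frac{1}{\Gamma(\alpha)}\int_{t_0}^{t}(t-\tau)^{\alpha-1}\varphi(\tau)\,d\tau$ and $(I_{t_1-}^{\alpha}\varphi)(t)=\frac{1}{\Gamma(\alpha)}\int_{t}^{t_1}(\tau-t)^{\alpha-1}\varphi(\tau)\,d\tau$ (left- and right-sided Riemann–Liouville fractional integrals); $I^0_{t_0+}\varphi=\varphi$. For $0<\alpha\le1$ the left-sided Caputo derivative is $({}^{c}D_{t_0+}^{\alpha}\varphi)(t)=\frac{d}{dt}\big(I_{t_0+}^{1-\alpha}(\varphi(\cdot)-\varphi(t_0))\big)(t)$. $C^{\alpha}([t_0,t_1],\mathbb{R}^n)$ is the set of functions of the form $\varphi(t)=\varphi(t_0)+(I_{t_0+}^{\alpha}\psi)(t)$ with $\psi\in C([t_0,t_1],\mathbb{R}^n)$; then ${}^{c}D_{t_0+}^{\alpha}\varphi=\psi$. Its norm is $\|y\|_{C^\alpha}=\max_{t\in[t_0,t_1]}\|y(t)\|+\max_{t\in[t_0,t_1]}\|({}^{c}D_{t_0+}^{\alpha}y)(t)\|$.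 All functions in $C^{\alpha}([t_0,t_1],\mathbb{R}^n)$ are admissible. A function $x^0$ delivers a weak local minimum in $(PB)$ if there is $\delta>0$ such that $B(x(\cdot))\ge B(x^0(\cdot))$ for every $x\in C^{\alpha}([t_0,t_1],\mathbb{R}^n)$ with $\|x-x^0\|_{C^\alpha}<\delta$. $L_x,L_y\in\mathbb{R}^n$ denote the gradients of $L$ in $x$ and $y$. Conventions: neighborhoods of the graph are relative to $[t_0,t_1]\times\mathbb{R}^n\times\mathbb{R}^n$; $0^0=1$; at $t=t_1$ the term containing $I_{t_1-}^{\alpha}b$ has the value $0$ (which is also its limit as $t\to t_1$). *)

(* Defs.v *)
(* R^n is ['rV[R]_n].  A function on [t0, t1] is a total function on R of which
   only the values on [`[t0, t1]] are used. *)
From HB Require Import structures.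
From mathcomp Require Import all_boot all_order all_algebra.
From mathcomp Require Import all_classical all_reals all_analysis.
Set Implicit Arguments.
Unset Strict Implicit.
Unset Printing Implicit Defensive.
Import Order.TTheory GRing.Theory Num.Theory.
Import numFieldNormedType.Exports.
Local Open Scope classical_set_scope.
Local Open Scope ring_scope.

Section FractionalCalculus.
Context {R : realType} {n : nat}.
Implicit Types (phi psi y : R -> 'rV[R]_n) (a t : R).

Definition Gamma a : R :=
  \int[lebesgue_measure]_(s in `]0%R, +oo[) (s `^ (a - 1) * expR (- s)).

Definition vint (D : set R) phi : 'rV[R]_n :=
  \row_i \int[lebesgue_measure]_(s in D) phi s ord0 i.

Definition RLleft t0 a phi t : 'rV[R]_n :=
  if a == 0 then phi t else
  (Gamma a)^-1 *: vint `[t0, t] (fun s => (t - s) `^ (a - 1) *: phi s).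

Definition RLright t1 a phi t : 'rV[R]_n :=
  (Gamma a)^-1 *: vint `[t, t1] (fun s => (s - t) `^ (a - 1) *: phi s).

(* Derivative of a function on [t0, t1]: the increments stay in [t0, t1], so it
   is one-sided at the two endpoints. *)
Definition derive_on t0 t1 phi t : 'rV[R]_n :=
  lim ((fun s => (s - t)^-1 *: (phi s - phi t)) @ within `[t0, t1] t^').

Definition Caputo t0 t1 a phi t : 'rV[R]_n :=
  derive_on t0 t1 (RLleft t0 (1 - a) (fun s => phi s - phi t0)) t.

Definition Calpha t0 t1 a phi : Prop :=
  exists psi, {within `[t0, t1], continuous psi} /\
    forall t, t \in `[t0, t1] -> phi t = phi t0 + RLleft t0 a psi t.

(* [`|v|] on ['rV[R]_n] is the max norm; this is the Euclidean one. *)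
Definition enorm (v : 'rV[R]_n) : R := Num.sqrt (\sum_i v ord0 i ^+ 2).

(* For [y] in C^alpha both suprema are maxima of continuous functions. *)
Definition Calpha_norm t0 t1 a y : R :=
  sup [set enorm (y t) | t in `[t0, t1]] +
  sup [set enorm (Caputo t0 t1 a y t) | t in `[t0, t1]].

Definition gradient (f : 'rV[R]_n -> R) (x : 'rV[R]_n) : 'rV[R]_n :=
  \row_i 'D_(delta_mx ord0 i) f x.

Definition has_gradient (f : 'rV[R]_n -> R) (x : 'rV[R]_n) : Prop :=
  forall i, derivable f x (delta_mx ord0 i).

Definition Bolza t0 t1 a b (L : R -> 'rV[R]_n -> 'rV[R]_n -> R)
    (l : 'rV[R]_n -> 'rV[R]_n -> R) (x : R -> 'rV[R]_n) : R :=
  \int[lebesgue_measure]_(t in `[t0, t1])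
    ((t1 - t) `^ (b - 1) * L t (x t) (Caputo t0 t1 a x t)) +
  l (x t0) (x t1).

Definition weak_local_min t0 t1 a (B : (R -> 'rV[R]_n) -> R)
    (x0 : R -> 'rV[R]_n) : Prop :=
  Calpha t0 t1 a x0 /\
  exists2 delta : R, 0 < delta &
    forall x, Calpha t0 t1 a x -> Calpha_norm t0 t1 a (x \- x0) < delta ->
      B x0 <= B x.

(* [U] is open in R x R^n x R^n, so its trace on [t0, t1] x R^n x R^n is a
   relative neighborhood of the graph of [(x, y)]. *)
Definition smooth_near_graph t0 t1 (L : R -> 'rV[R]_n -> 'rV[R]_n -> R)
    (x y : R -> 'rV[R]_n) : Prop :=
  exists U : set (R * 'rV[R]_n * 'rV[R]_n),
    let A := U `&` [set p | p.1.1 \in `[t0, t1]] in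
    [/\ open U,
        forall t, t \in `[t0, t1] -> U (t, x t, y t),
        forall p, A p -> has_gradient (fun u => L p.1.1 u p.2) p.1.2 /\
                         has_gradient (fun v => L p.1.1 p.1.2 v) p.2,
        {within A, continuous (fun p => L p.1.1 p.1.2 p.2)} &
        {within A, continuous
          (fun p => gradient (fun u => L p.1.1 u p.2) p.1.2)} /\
        {within A, continuous
          (fun p => gradient (fun v => L p.1.1 p.1.2 v) p.2)}].

(* The two partial gradients are the coordinates of the differential, so their
   continuity is the continuity of the differential. *)
Definition C1_near (l : 'rV[R]_n -> 'rV[R]_n -> R)
    (p0 : 'rV[R]_n * 'rV[R]_n) : Prop :=
  \forall p \near p0,
    [/\ differentiable (fun q : 'rV[R]_n * 'rV[R]_n => l q.1 q.2) p,
        {for p, continuous (fun q : 'rV[R]_n * 'rV[R]_n =>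
                              gradient (fun u => l u q.2) q.1)} &
        {for p, continuous (fun q : 'rV[R]_n * 'rV[R]_n =>
                              gradient (fun v => l q.1 v) q.2)}].

End FractionalCalculus.

(* Main.v *)
Require Import Defs.
From HB Require Import structures.
From mathcomp Require Import all_boot all_order all_algebra.
From mathcomp Require Import all_classical all_reals all_analysis.
From mathcomp Require Import measurable_realfun ring lra.
Import Order.TTheory GRing.Theory Num.Theory.
Import numFieldNormedType.Exports.
Set Implicit Arguments.
Unset Strict Implicit.
Unset Printing Implicit Defensive.
Local Open Scope classical_set_scope.
Local Open Scope ring_scope.

(** Perturb the minimizer in a single coordinate by [s * h], where
[h = c + I^alpha g] and [g] is continuous, so that the Caputo derivative is
perturbed by [s * g] (the semigroup law [I^(1 - alpha) I^alpha = I^1] rests on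
Euler's identity [B(alpha, 1 - alpha) = Gamma(alpha) Gamma(1 - alpha)]).  By
compactness of the graph and the mean value theorem the integrand has a
first-order expansion in [s] that is uniform in [t], hence the first variation
vanishes.  Taking [g = 0] gives the transversality condition.  Taking [c = 0]
and exchanging the two integrals gives, with [m = min(alpha, beta)],
[int (t1 - t)^(m - 1) g(t) H(t) dt = 0] for every continuous [g], where
[H(t) = (t1 - t)^(alpha + beta - m) K(t) / Gamma(alpha) + (t1 - t)^(beta - m) L_y(t)
+ l_{x1} (t1 - t)^(alpha - m) / Gamma(alpha)], and
[K(t) = int_0^1 u^(alpha - 1) (1 - u)^(beta - 1) L_x(t + (t1 - t) u) du] comes
from rescaling [I_{t1-}^alpha b].  Since [K] is continuous up to [t1], so is
[H], and [g = H] yields [H = 0] on the closed interval; when [alpha < beta] its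
value at [t1] is [l_{x1} / Gamma(alpha)]. *)

(** * Affine substitution and power kernels *)

(** The equations are claimed up to [t1], where the right-sided kernel, the weight of the functional
    and the endpoint term can all be singular. The choice of [m] removes this: [m <= alpha] and
    [m <= beta] leave only nonnegative powers in [H], so [H] is itself a legitimate test function,
    while [m <= 1] keeps the weight [(t1 - t)^(m - 1)] bounded below on [[t0, t1[] by its value at
    [t0], so a vanishing weighted integral of [H^2] forces [H = 0]. Continuity of [H] then delivers
    the equation at [t1] itself.

    The integral lemmas speak of measurable or continuous bounded functions on all of R; data given
    only on [[t0, t1]] enter through a bounded continuous extension. A real integral is read as 0
    when it diverges, and [powR] at base 0 is 0 or 1 whatever the exponent. Hence integrability
    accompanies the linear manipulations, and identities between singular powers are used only off
    the critical endpoint, which is a null set. *)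

Lemma lebesgue_measure_affine (R : realType) (c d : R) (A : set R) : c != 0 ->
  measurable A ->
  (lebesgue_measure A =
   `|c|%:E * lebesgue_measure ((fun x : R => c * x + d)%R @^-1` A))%E.
Proof.
move=> c0 mA.
pose phi : measurableTypeR R -> measurableTypeR R := fun x => c * x + d.
have mphi : measurable_fun [set: measurableTypeR R] phi.
  by apply: measurable_funD => //; apply: measurable_funM.
pose mphi_mixin := isMeasurableFun.Build _ _ _ _ phi mphi.
pose phi' : {mfun measurableTypeR R >-> measurableTypeR R} :=
  HB.pack phi mphi_mixin.
pose c' : {nonneg R} := NngNum (normr_ge0 c).
(* By uniqueness it suffices to compare lengths of half-open intervals; for [c < 0] the preimage is
   half-open on the other side, with the same length. *)
apply: (@lebesgue_measure_unique R (mscale c' (pushforward lebesgue_measure phi'))) => //.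
move=> _ [[a b]] /= _ <-.
suff -> : lebesgue_measure `]a, b]%classic =
    (`|c|%:E * lebesgue_measure (phi @^-1` `]a, b]%classic))%E by [].
rewrite lebesgue_measure_itv /=.
have [cp|cn|/eqP] := ltgtP 0 c; last by rewrite eq_sym (negPf c0).
- rewrite [X in lebesgue_measure X](_ : _ = `](a - d) / c, (b - d) / c]%classic); last first.
    apply/seteqP; split => x /=; rewrite !in_itv /= /phi;
    by rewrite ltr_pdivrMr // ler_pdivlMr // (mulrC x) ltrBlDr lerBrDr.
  rewrite lebesgue_measure_itv /= !lte_fin ltr_pM2r ?invr_gt0 // ltrD2r.
  case: ifPn => _; last by rewrite mule0.
  rewrite -EFinM; congr EFin; rewrite gtr0_norm //; field.
  by rewrite gt_eqF.
- rewrite [X in lebesgue_measure X](_ : _ = `[(b - d) / c, (a - d) / c[%classic); last first.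
    apply/seteqP; split => x /=; rewrite !in_itv /= /phi;
    by rewrite ltr_ndivlMr // ler_ndivrMr // (mulrC x) ltrBlDr lerBrDr andbC.
  rewrite lebesgue_measure_itv /= !lte_fin ltr_nM2r ?invr_lt0 // ltrD2r.
  case: ifPn => _; last by rewrite mule0.
  rewrite -EFinM; congr EFin; rewrite ltr0_norm //; field.
  exact: c0.
Qed.

(** The scaling passes from sets to nonnegative functions by a pushforward, then to [f] through its
    positive and negative parts. Being an identity in the extended reals, it also transports
    integrability. *)
Lemma integral_affine (R : realType) (c d : R) (f : R -> \bar R) : c != 0 ->
  measurable_fun [set: R] f ->
  (\int[lebesgue_measure]_x f x =
   `|c|%:E * \int[lebesgue_measure]_x f (c * x + d)%R)%E.
Proof.
move=> c0 mf.
pose phi : measurableTypeR R -> measurableTypeR R := fun x => c * x + d.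
have mphi : measurable_fun [set: measurableTypeR R] phi.
  by apply: measurable_funD => //; apply: measurable_funM.
pose mphi_mixin := isMeasurableFun.Build _ _ _ _ phi mphi.
pose phi' : {mfun measurableTypeR R >-> measurableTypeR R} :=
  HB.pack phi mphi_mixin.
pose c' : {nonneg R} := NngNum (normr_ge0 c).
have key g : measurable_fun [set: R] g -> (forall x, (0 <= g x)%E) ->
  (\int[lebesgue_measure]_x g x =
   `|c|%:E * \int[lebesgue_measure]_x g (c * x + d)%R)%E.
  move=> mg g0.
  rewrite (eq_measure_integral (mscale c' (pushforward lebesgue_measure phi'))); last first.
    by move=> A mA _; exact: (lebesgue_measure_affine d c0 mA).
  rewrite ge0_integral_mscale //=.
  by rewrite ge0_integral_pushforward //=.
rewrite integralE [in RHS]integralE.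
rewrite (key f^\+%E) //; last exact: measurable_funepos.
rewrite (key f^\-%E) //; last exact: measurable_funeneg.
(* Distributivity needs care in the extended reals: [+oo - +oo] is [-oo], and scaling by a positive
   real must respect this. *)
have aux (A B : \bar R) : (0 <= A)%E -> (0 <= B)%E ->
    (`|c|%:E * A - `|c|%:E * B = `|c|%:E * (A - B))%E.
  have cp : (0 < `|c|%:E)%E by rewrite lte_fin normr_gt0.
  case: A => [a| |] A0 //; case: B => [b| |] B0 //.
  - by rewrite -EFinM -EFinM -EFinB -EFinB -EFinM mulrBr.
  - by rewrite /= gt0_muleNy // gt0_muley.
  - by rewrite /= gt0_muley.
  - by rewrite /= gt0_muley //= gt0_muleNy.
rewrite aux; [|exact: integral_ge0|exact: integral_ge0].
rewrite /= -/phi.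
rewrite -!/(_ \o phi) -(funepos_comp f phi) -(funeneg_comp f phi).
reflexivity.
Qed.

(** * Integrability of one- and two-sided power kernels *)

Section PowerKernels.
Context {R : realType}.
Notation mu := (@lebesgue_measure R).
Implicit Types a b c d p q x y : R.

Lemma continuous_powR p x : 0 < x -> {for x, continuous (@powR R ^~ p)}.
Proof.
move=> x0; apply: differentiable_continuous; apply/derivable1_diffP.
by apply: derivable_powR; rewrite in_itv /= x0.
Qed.

(** For [p < 1] the integrand is singular at 0, out of reach of the fundamental theorem of calculus.
    The interval is exhausted by the [[1/(n+1), x]], on each of which the integral is at most
    [x^p / p], and monotone convergence concludes. *)
Lemma integral_powR_le p x : 0 < p -> 0 < x ->
  (\int[mu]_(s in `]0%R, x]) (s `^ (p - 1))%:E <= (x `^ p / p)%:E)%E.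
Proof.
move=> p0 x0.
pose F (n : nat) := `[(n.+1%:R^-1 : R), x]%classic.
have UF : `]0%R, x]%classic = \bigcup_n F n.
  apply/seteqP; split => [y|y [n _]]; rewrite ?/F /= !in_itv /=.
  - move=> /andP[y0 yx].
    have [n /= ny] : exists n, n.+1%:R^-1 < y.
      by exists (Num.truncn (y^-1)); rewrite invf_plt ?posrE // truncnS_gt.
    by exists n => //=; rewrite /F /= in_itv /= (ltW ny).
  - by move=> /andP[ny ->]; rewrite andbT; apply: lt_le_trans ny.
rewrite UF.
have ndF : nondecreasing_seq F.
  move=> n m nm; apply/subsetPset => y; rewrite /F /= !in_itv /= => /andP[h ->].
  by rewrite andbT (le_trans _ h)// lef_pV2 ?posrE// ler_nat.
have mf : measurable_fun setT (fun s : R => (s `^ (p - 1))%:E).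
  by apply/measurable_EFinP; exact: measurable_powR.
have cv : (\int[mu]_(s in F i) (s `^ (p - 1))%:E @[i --> \oo] -->
    \int[mu]_(s in \bigcup_i F i) (s `^ (p - 1))%:E)%E.
  apply: ge0_nondecreasing_set_cvg_integral => //.
  - by move=> i; exact: measurable_itv.
  - by move=> i; exact: measurable_funTS.
  - by move=> i y _; rewrite lee_fin powR_ge0.
rewrite -(cvg_lim _ cv) //.
apply: lime_le; first exact: cvgP cv.
near=> n.
have nx : n.+1%:R^-1 < x by near: n; exact: near_infty_natSinv_lt (PosNum x0).
have n0 : 0 < n.+1%:R^-1 :> R by rewrite invr_gt0.
rewrite (@continuous_FTC2 _ _ (fun s => s `^ p / p)) //.
- rewrite -EFinB lee_fin lerBlDr lerDl divr_ge0 ?powR_ge0 //; exact: ltW.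
- apply: continuous_in_subspaceT => y; rewrite inE /= in_itv /= => /andP[yn _].
  by apply: continuous_powR; exact: lt_le_trans yn.
- have H y : 0 < y -> {for y, continuous (fun s => s `^ p / p)}.
    move=> y0; apply: cvgM; last exact: cvg_cst.
    exact: continuous_powR.
  split.
  + move=> y; rewrite in_itv /= => /andP[yn _]; apply: derivableM => //.
    apply: derivable_powR; rewrite in_itv /= andbT; exact: lt_trans yn.
  + by apply: cvg_at_right_filter; exact: H.
  + by apply: cvg_at_left_filter; exact: H.
- move=> y; rewrite in_itv /= => /andP[yn _].
  have y0 : 0 < y by exact: lt_trans yn.
  rewrite derive1E deriveMr; last first.
    by apply: derivable_powR; rewrite in_itv /= y0.
  rewrite -derive1E powR_derive1 ?in_itv /= ?y0 //.
  by rewrite mulKf // gt_eqF.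
Unshelve. all: by end_near. Qed.

Lemma integrable_powR p x : 0 < p -> 0 < x ->
  mu.-integrable `[0%R, x] (fun s => (s `^ (p - 1))%:E).
Proof.
move=> p0 x0; apply/integrableP; split.
  by apply/measurable_EFinP/measurable_funTS; exact: measurable_powR.
rewrite -integral_itv_obnd_cbnd; last first.
  apply: measurableT_comp => //.
  by apply/measurable_EFinP/measurable_funTS; exact: measurable_powR.
under eq_integral do rewrite gee0_abs ?lee_fin ?powR_ge0 //.
by apply: le_lt_trans (integral_powR_le p0 x0) _; rewrite ltry.
Qed.

Lemma integral_itv01 a b (f : R -> \bar R) : a < b ->
  measurable_fun [set: R] f ->
  (\int[mu]_(t in `[a, b]) f t =
   (b - a)%:E * \int[mu]_(u in `[0%R, 1%R]) f (a + (b - a) * u)%R)%E.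
Proof.
move=> ab mf; have ba : 0 < b - a by rewrite subr_gt0.
rewrite integral_mkcond (@integral_affine _ (b - a) a) ?gt_eqF//; last first.
  by apply/(measurable_restrictT f) => //; exact: measurable_funTS.
rewrite gtr0_norm // [in RHS]integral_mkcond; congr (_ * _)%E.
apply: eq_integral => u _; rewrite !patchE.
have -> : ((b - a) * u + a \in `[a, b]%classic) = (u \in `[0%R, 1%R]%classic).
  apply/idP/idP; rewrite !inE /= !in_itv /= lerDr -lerBrDr -{3}(mulr1 (b - a));
    by rewrite ler_pM2l // pmulr_rge0.
by rewrite addrC.
Qed.

Lemma integral_onem (f : R -> \bar R) : measurable_fun [set: R] f ->
  (\int[mu]_(u in `[0%R, 1%R]) f u = \int[mu]_(u in `[0%R, 1%R]) f (1 - u)%R)%E.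
Proof.
move=> mf.
rewrite integral_mkcond (@integral_affine _ (- 1) 1) ?oppr_eq0 ?oner_eq0 //; last first.
  by apply/(measurable_restrictT f) => //; exact: measurable_funTS.
rewrite normrN normr1 mul1e [in RHS]integral_mkcond.
apply: eq_integral => u _; rewrite !patchE.
rewrite mulN1r addrC.
suff -> : (1 - u \in `[0%R, 1%R]%classic) = (u \in `[0%R, 1%R]%classic) by [].
by apply/idP/idP; rewrite !inE /= !in_itv /= => /andP[? ?]; apply/andP; split; lra.
Qed.

Lemma Rintegral_itv01 a b (f : R -> R) : a < b ->
  measurable_fun [set: R] f ->
  \int[mu]_(t in `[a, b]) f t =
   (b - a) * \int[mu]_(u in `[0, 1]) f (a + (b - a) * u).
Proof.
move=> ab mf; have ba : 0 < b - a by rewrite subr_gt0.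
rewrite /Rintegral integral_itv01 //; last exact/measurable_EFinP.
(* An infinite integral is read as 0 by [fine], and so is its multiple by [b - a], so the two sides
   still agree. *)
set X := integral _ _ _.
by case: X => [r| |] //=; rewrite mulr_infty gtr0_sg //= mul1e mulr0.
Qed.

Lemma integrable_itv01 a b (f : R -> R) : a < b ->
  measurable_fun [set: R] f ->
  mu.-integrable `[a, b] (EFin \o f) <->
  mu.-integrable `[0, 1] (fun u => (f (a + (b - a) * u))%:E).
Proof.
move=> ab mf; have ba : 0 < b - a by rewrite subr_gt0.
have mf' : measurable_fun setT (EFin \o f) by exact/measurable_EFinP.
have mf1 : measurable_fun setT (fun u => (f (a + (b - a) * u))%:E).
  apply/measurable_EFinP; apply: (measurableT_comp mf).
  by apply: measurable_funD => //; exact: measurable_funM.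
have E := integral_itv01 ab (measurableT_comp (@abse_measurable R setT) mf').
split => /integrableP[_ h]; apply/integrableP; split; try exact: measurable_funTS.
- move: h; rewrite [X in (X < _)%E]E /=.
  have -> : (\int[mu]_(u in `[0%R, 1%R]) `|(f (a + (b - a) * u))%:E| =
    \int[mu]_(u in `[0%R, 1%R]) `|f (a + (b - a) * u)|%:E)%E by [].
  set X := integral _ _ _; rewrite ltey => XE; rewrite ltey; apply: contra XE.
  by move=> /eqP ->; rewrite gt0_muley ?lte_fin.
- rewrite [X in (X < _)%E]E; apply: lte_mul_pinfty => //.
  by rewrite lee_fin ltW.
Qed.

(** One bound for both signs of [p]: the power is at most 1 when it increases, at most [x^p] when it
    decreases. *)
Lemma powR_le_max p x y : 0 < x -> x <= y <= 1 -> y `^ p <= 1 + x `^ p.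
Proof.
move=> x0 /andP[xy y1]; have y0 := lt_le_trans x0 xy.
have [p0|p0] := leP 0 p.
  rewrite (@le_trans _ _ 1) ?lerDl ?powR_ge0 //.
  have -> : 1 = (1 : R) `^ p by rewrite powR1.
  by apply: ge0_ler_powR => //; rewrite nnegrE ltW.
rewrite (@le_trans _ _ (x `^ p)) ?lerDr //.
rewrite -(opprK p) !(powRN _ (- p)) lef_pV2 ?posrE ?powR_gt0 //.
apply: ge0_ler_powR => //; rewrite ?nnegrE ?ltW //.
by rewrite oppr_gt0.
Qed.

Lemma measurable_beta_kernel a b p q :
  measurable_fun [set: R] (fun t => (t - a) `^ p * (b - t) `^ q).
Proof.
apply: measurable_funM.
  apply: (measurableT_comp (measurable_powR p)).
  exact: measurable_funB.
apply: (measurableT_comp (measurable_powR q)).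
exact: measurable_funB.
Qed.

Lemma integrable_beta p q : 0 < p -> 0 < q ->
  mu.-integrable `[0, 1] (fun u => (u `^ (p - 1) * (1 - u) `^ (q - 1))%:E).
Proof.
move=> p0 q0.
(* At each [u] one of the two bases is at least 1/2, so that factor is bounded by [powR_le_max]. [C]
   absorbs both bounds: [C] times the sum of the factors dominates their product. *)
pose C := 2 + (2^-1 : R) `^ (p - 1) + (2^-1) `^ (q - 1).
have mk : measurable_fun [set: R] (fun u => u `^ (p - 1) * (1 - u) `^ (q - 1)).
  have := measurable_beta_kernel 0 1 (p - 1) (q - 1).
  by under eq_fun do rewrite subr0.
have mp r : measurable_fun [set: R] (fun u : R => (1 - u) `^ r).
  apply: (measurableT_comp (measurable_powR r)).
  exact: measurable_funB.
have i1 : mu.-integrable `[0, 1] (fun u => (u `^ (p - 1))%:E).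
  exact: integrable_powR.
have i2 : mu.-integrable `[0, 1] (fun u => ((1 - u) `^ (q - 1))%:E).
  have /integrableP[_ h] := @integrable_powR q 1 q0 ltr01.
  apply/integrableP; split.
    by apply/measurable_EFinP; apply: measurable_funTS; exact: mp.
  rewrite integral_onem /=; last first.
    apply/measurable_EFinP/measurableT_comp => //; exact: mp.
  apply: le_lt_trans h.
  by under eq_integral do rewrite subKr.
have i3 : mu.-integrable `[0, 1]
    (fun u => (C%:E * ((u `^ (p - 1))%:E + ((1 - u) `^ (q - 1))%:E))%E).
  by apply: integrableZl => //; exact: integrableD.
apply: (le_integrable _ _ _ i3) => //.
  by apply/measurable_EFinP; exact: measurable_funTS.
move=> u /=; rewrite in_itv /= => /andP[u0 u1].
rewrite lee_fin !ger0_norm ?mulr_ge0 ?addr_ge0 ?powR_ge0 //.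
set A := u `^ _; set B := (1 - u) `^ _.
have A0 : 0 <= A by exact: powR_ge0.
have B0 : 0 <= B by exact: powR_ge0.
have h p' : 0 <= (2^-1 : R) `^ p' by exact: powR_ge0.
have := h (p - 1); have := h (q - 1); rewrite /C => h2 h1.
have [u2|u2] := leP u 2^-1.
  have : B <= 1 + (2^-1) `^ (q - 1).
    by apply: powR_le_max => //; apply/andP; split; lra.
  nra.
have : A <= 1 + (2^-1) `^ (p - 1).
  by apply: powR_le_max => //; apply/andP; split; lra.
nra.
Qed.

Lemma integrable_beta_kernel a b p q : a < b -> 0 < p -> 0 < q ->
  mu.-integrable `[a, b] (fun t => ((t - a) `^ (p - 1) * (b - t) `^ (q - 1))%:E).
Proof.
move=> ab p0 q0; have ba : 0 < b - a by rewrite subr_gt0.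
apply/(integrable_itv01 ab (measurable_beta_kernel a b (p - 1) (q - 1))).
have : mu.-integrable `[0, 1] (fun u => (((b - a) `^ (p - 1) * (b - a) `^ (q - 1))%:E *
    (u `^ (p - 1) * (1 - u) `^ (q - 1))%:E)%E).
  by apply: integrableZl => //; exact: integrable_beta.
apply: eq_integrable => // u; rewrite inE /= in_itv /= => /andP[u0 u1].
rewrite -EFinM; congr EFin.
have ba0 := ltW ba; have u1' : 0 <= 1 - u by rewrite subr_ge0.
rewrite mulrACA -!powRM //.
by congr (_ `^ _ * _ `^ _); ring.
Qed.

End PowerKernels.

(** * Exchange of integrals on a triangle *)

Section TriangleFubini.
Context {R : realType}.
Notation mu := (@lebesgue_measure R).
Implicit Types (a b p q M x y : R) (f g h : R -> R).

Lemma integrable_itvcc1 a (f : R -> R) : mu.-integrable `[a, a] (EFin \o f).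
Proof.
rewrite set_itv1; apply: null_set_integrable => //.
  by apply/measurable_EFinP; exact: measurable_fun_set1.
by rewrite /= lebesgue_measure_set1.
Qed.

Lemma integrable_kernelM a b p q M h : a <= b -> 0 < p -> 0 < q ->
  measurable_fun [set: R] h -> (forall t, `|h t| <= M) ->
  mu.-integrable `[a, b]
    (fun t => ((t - a) `^ (p - 1) * ((b - t) `^ (q - 1) * h t))%:E).
Proof.
rewrite le_eqVlt => /predU1P[->|ab] p0 q0 mh hM; first exact: integrable_itvcc1.
have i1 : mu.-integrable `[a, b]
    (fun t => (M%:E * ((t - a) `^ (p - 1) * (b - t) `^ (q - 1))%:E)%E).
  by apply: integrableZl => //; exact: integrable_beta_kernel.
apply: (le_integrable _ _ _ i1) => //.
  apply/measurable_EFinP; apply: measurable_funTS.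
  rewrite [X in measurable_fun _ X](_ : _ = fun t : R =>
    ((t - a) `^ (p - 1) * (b - t) `^ (q - 1)) * h t); last first.
    by apply/funext => t; rewrite mulrA.
  apply: measurable_funM; last exact: mh.
  exact: measurable_beta_kernel.
move=> t /= _; rewrite lee_fin mulrA normrM [in leRHS]normrM mulrC.
by apply: ler_wpM2r => //; apply: le_trans (hM t) (ler_norm _).
Qed.

Lemma integrable_left_kernelM a b p M h : a <= b -> 0 < p ->
  measurable_fun [set: R] h -> (forall t, `|h t| <= M) ->
  mu.-integrable `[a, b] (fun s => ((b - s) `^ (p - 1) * h s)%:E).
Proof.
move=> ab p0 mh hM.
apply: eq_integrable (integrable_kernelM ab ltr01 p0 mh hM) => //.
by move=> t _; rewrite subrr powRr0 mul1r.
Qed.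

(** Rescaling to [[0, 1]] pulls out [(t - a)^p], at most [(b - a)^p], so one bound serves all [t].
    It is the majorant in the Tonelli step of [triangle_Fubini]. *)
Lemma left_kernel_ub a b p M h : 0 < p ->
  measurable_fun [set: R] h -> (forall t, `|h t| <= M) ->
  exists C, forall t, t \in `[a, b] ->
    `|\int[mu]_(s in `[a, t]) ((t - s) `^ (p - 1) * h s)| <= C.
Proof.
move=> p0 mh hM.
have M0 : 0 <= M by apply: le_trans (hM 0).
pose K := \int[mu]_(u in `[0, 1]) (1 - u) `^ (p - 1).
have K0 : 0 <= K by apply: Rintegral_ge0 => u _; exact: powR_ge0.
exists (M * ((b - a) `^ p * K)) => t; rewrite in_itv /= => /andP[].
rewrite le_eqVlt => /predU1P[<- ab|at_ tb].
  by rewrite set_itv1 Rintegral_set1 normr0 mulr_ge0 // mulr_ge0 // powR_ge0.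
have ii := integrable_left_kernelM (ltW at_) p0 mh hM.
have i1 := @integrable_left_kernelM a t p 1 (cst 1) (ltW at_) p0
  (measurable_cst _) (fun=> ltac:(by rewrite normr1)).
have mk r : measurable_fun [set: R] (fun s : R => (r - s) `^ (p - 1)).
  apply: (measurableT_comp (measurable_powR (p - 1))).
  exact: measurable_funB.
apply: le_trans (le_normr_Rintegral _ ii) _ => //.
apply: (@le_trans _ _ (\int[mu]_(s in `[a, t]) (M * ((t - s) `^ (p - 1) * 1)))).
  apply: le_Rintegral => //.
  - exact: integrable_norm.
  - by apply: (integrableZl _ _ i1).
  - move=> s _; rewrite normrM ger0_norm ?powR_ge0 // mulr1 mulrC.
    by apply: ler_wpM2r => //; exact: powR_ge0.
rewrite RintegralZl //; apply: ler_wpM2l => //.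
under eq_Rintegral do rewrite mulr1.
rewrite Rintegral_itv01 //.
have ta : 0 <= t - a by rewrite subr_ge0 ltW.
rewrite (_ : \int[mu]_(u in `[0, 1]) (t - (a + (t - a) * u)) `^ (p - 1) =
             (t - a) `^ (p - 1) * K); last first.
  rewrite -RintegralZl //; last first.
    apply: eq_integrable (@integrable_left_kernelM 0 1 p 1 (cst 1) ler01 p0
     (measurable_cst _) (fun=> ltac:(by rewrite normr1))) => //.
    by move=> u _; rewrite /= mulr1.
  apply: eq_Rintegral => u; rewrite inE /= in_itv /= => /andP[u0 u1].
  have u1' : 0 <= 1 - u by rewrite subr_ge0.
  by rewrite -powRM //; congr (_ `^ _); ring.
rewrite mulrA mulr_powRB1 //; apply: ler_wpM2r => //.
by apply: ge0_ler_powR; rewrite ?nnegrE; lra.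
Qed.


Let mem_itvcc (c d x : R) : (x \in `[c, d]%classic) = (c <= x <= d).
Proof. by apply/idP/idP; rewrite inE /= in_itv. Qed.

Let indic_itvcc (c d x : R) : \1_`[c, d] x = (c <= x <= d)%R%:R :> R.
Proof. by rewrite indicE mem_itvcc. Qed.

Let indic_itvcy (c x : R) : \1_`[c, +oo[ x = (c <= x)%R%:R :> R.
Proof.
rewrite indicE; congr (_%:R); congr nat_of_bool.
by apply/idP/idP; rewrite inE /= in_itv /= andbT.
Qed.

(** Common integrand of the two iterated integrals, with [z = (t, s)], cut off outside
    [a <= s <= t <= b]. The cut-off is a product of indicators, so joint measurability follows
    factor by factor. *)
Let tri a b p q f g (z : R * R) : R :=
  \1_`[a, b] z.1 * \1_`[a, b] z.2 * \1_`[0, +oo[ (z.1 - z.2) *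
  ((b - z.1) `^ (q - 1) * f z.1 * ((z.1 - z.2) `^ (p - 1) * g z.2)).

Let measurable_tri a b p q f g : measurable_fun [set: R] f ->
  measurable_fun [set: R] g -> measurable_fun [set: R * R] (tri a b p q f g).
Proof.
move=> mf mg.
have m1 : measurable_fun [set: R * R] (fun z : R * R => z.1) by exact: measurable_fst.
have m2 : measurable_fun [set: R * R] (fun z : R * R => z.2) by exact: measurable_snd.
have m12 : measurable_fun [set: R * R] (fun z : R * R => z.1 - z.2).
  exact: measurable_funB.
have mI (A : set R) : measurable A -> measurable_fun [set: R] (\1_A : R -> R).
  by move=> mA; exact: measurable_indic.
have mP r : measurable_fun [set: R] (fun s : R => s `^ r) by exact: measurable_powR.
rewrite /tri; repeat apply: measurable_funM.
- by apply: (measurableT_comp _ m1); apply: mI.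
- by apply: (measurableT_comp _ m2); apply: mI.
- by apply: (measurableT_comp _ m12); apply: mI.
- apply: (measurableT_comp (mP _)); exact: measurable_funB.
- exact: (measurableT_comp mf m1).
- exact: (measurableT_comp (mP _) m12).
- exact: (measurableT_comp mg m2).
Qed.

Let tri_inner1 a b p q M f g t : 0 < p ->
  measurable_fun [set: R] g -> (forall t, `|g t| <= M) ->
  (\int[mu]_s (tri a b p q f g (t, s))%:E =
   (\1_`[a, b] t * ((b - t) `^ (q - 1) * f t *
      \int[mu]_(s in `[a, t]) ((t - s) `^ (p - 1) * g s)))%:E)%E.
Proof.
move=> p0 mg gM; rewrite indic_itvcc.
have [/andP[at_ tb]|tab] := boolP (a <= t <= b); last first.
  rewrite mul0r integral0_eq // => s _.
  by rewrite /tri /= indic_itvcc (negPf tab) !mul0r.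
rewrite mul1r.
have ii := integrable_left_kernelM at_ p0 mg gM.
rewrite -RintegralZl // /Rintegral fineK; last first.
  by apply: integrable_fin_num => //; exact: (integrableZl _ _ ii).
rewrite [in RHS]integral_mkcond; apply: eq_integral => s _.
rewrite patchE /tri /= !indic_itvcc indic_itvcy mem_itvcc at_ tb mul1r subr_ge0.
case: (leP a s) => /= h1; last by rewrite !mul0r.
case: (leP s t) => /= h2; last by rewrite mulr0 mul0r.
by rewrite (le_trans h2 tb) !mul1r.
Qed.

Let tri_inner2 a b p q M f g s : 0 < p -> 0 < q ->
  measurable_fun [set: R] f -> (forall t, `|f t| <= M) ->
  (\int[mu]_t (tri a b p q f g (t, s))%:E =
   (\1_`[a, b] s * (g s *
      \int[mu]_(t in `[s, b]) ((t - s) `^ (p - 1) * ((b - t) `^ (q - 1) * f t))))%:E)%E.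
Proof.
move=> p0 q0 mf fM; rewrite [in RHS]indic_itvcc.
have [/andP[as_ sb]|sab] := boolP (a <= s <= b); last first.
  rewrite mul0r integral0_eq // => t _.
  by rewrite /tri /= !indic_itvcc (negPf sab) mulr0 !mul0r.
rewrite mul1r.
have ii := integrable_kernelM sb p0 q0 mf fM.
rewrite -RintegralZl // /Rintegral fineK; last first.
  by apply: integrable_fin_num => //; exact: (integrableZl _ _ ii).
rewrite [in RHS]integral_mkcond; apply: eq_integral => t _.
rewrite patchE /tri /= !indic_itvcc indic_itvcy mem_itvcc as_ sb mulr1 subr_ge0.
case: (leP s t) => /= h1; last by rewrite mulr0 mul0r.
rewrite (le_trans as_ h1) /=; case: (leP t b) => /= h2; last by rewrite !mul0r.
by rewrite !mul1r; congr EFin; ring.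
Qed.

(** Dirichlet's formula. Both sides are iterated integrals of [tri] over the plane, so everything
    rests on its absolute integrability. *)
Lemma triangle_Fubini a b p q M f g : 0 < p -> 0 < q ->
  measurable_fun [set: R] f -> (forall t, `|f t| <= M) ->
  measurable_fun [set: R] g -> (forall t, `|g t| <= M) ->
  \int[mu]_(t in `[a, b]) ((b - t) `^ (q - 1) * f t *
      \int[mu]_(s in `[a, t]) ((t - s) `^ (p - 1) * g s)) =
  \int[mu]_(s in `[a, b]) (g s *
      \int[mu]_(t in `[s, b]) ((t - s) `^ (p - 1) * ((b - t) `^ (q - 1) * f t))).
Proof.
move=> p0 q0 mf fM mg gM.
have [ab|ab] := leP a b; last by rewrite set_itv_ge ?bnd_simp -?ltNge // !Rintegral_set0.
have mnf : measurable_fun [set: R] (Num.norm \o f) by exact: measurableT_comp.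
have mng : measurable_fun [set: R] (Num.norm \o g) by exact: measurableT_comp.
have nfM t : `|(Num.norm \o f) t| <= M by rewrite /= normr_id.
have ngM t : `|(Num.norm \o g) t| <= M by rewrite /= normr_id.
have M0 : 0 <= M by apply: le_trans (fM 0).
have mtri := measurable_tri a b p q mf mg.
have mntri := measurable_tri a b p q mnf mng.
(* The absolute value of [tri] is [tri] for [|f|] and [|g|], so [tri_inner1] also computes the inner
   integral of Tonelli's criterion; what remains is bounded by a multiple of the integrable
   [(b - t)^(q - 1)]. *)
have triN z : `|tri a b p q f g z| = tri a b p q (Num.norm \o f) (Num.norm \o g) z.
  rewrite /tri /= !normrM !(ger0_norm (powR_ge0 _ _)).
  by rewrite !indicE !normr_nat.
have triI : (mu \x mu)%E.-integrable [set: R * R] (EFin \o tri a b p q f g).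
  apply/integrable12ltyP; first exact/measurable_EFinP.
  under eq_integral do under eq_integral do rewrite /= triN.
  under eq_integral do rewrite (tri_inner1 a b q _ _ p0 mng ngM).
  have [C HC] := left_kernel_ub a b p0 mng ngM.
  have C0 : 0 <= C.
    by apply: le_trans (HC a _); rewrite ?in_itv /= ?lexx.
  have iq := @integrable_left_kernelM a b q 1 (cst 1) ab q0
    (measurable_cst _) (fun=> ltac:(by rewrite normr1)).
  have iq' : mu.-integrable `[a, b]
      (fun t => ((M * C)%:E * ((b - t) `^ (q - 1) * cst 1 t)%:E)%E).
    exact: integrableZl.
  apply: le_lt_trans (integrable_lty _ iq') => //.
  rewrite [leRHS]integral_mkcond.
  apply: ge0_le_integral => //=.
  - move=> t _; rewrite lee_fin mulr_ge0 // mulr_ge0 // ?mulr_ge0 ?powR_ge0 //.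
    by apply: Rintegral_ge0 => s _; rewrite mulr_ge0 // powR_ge0.
  - rewrite [X in measurable_fun _ X](_ : _ = fun t => (\int[mu]_s
        (tri a b p q (Num.norm \o f) (Num.norm \o g) (t, s))%:E)%E); last first.
      by apply/funext => t; rewrite (tri_inner1 a b q _ _ p0 mng ngM).
    have mE : measurable_fun [set: R * R]
        (EFin \o tri a b p q (Num.norm \o f) (Num.norm \o g)).
      exact/measurable_EFinP.
    apply: (@measurable_fun_fubini_tonelli_F _ _ (measurableTypeR R) (measurableTypeR R)
      R mu (EFin \o tri a b p q (Num.norm \o f) (Num.norm \o g)) mE).
    by move=> z; rewrite lee_fin -triN.
  - apply/(measurable_restrictT (fun t : R => ((M * C)%:E * ((b - t) `^ (q - 1) * cst 1 t)%:E)%E)) => //.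
    by case/integrableP : iq'.
  - move=> t _; rewrite patchE indic_itvcc mem_itvcc; case: ifPn => tab; last by rewrite mul0r.
    have := HC t; rewrite in_itv /= => /(_ tab).
    rewrite ger0_norm; last first.
      by apply: Rintegral_ge0 => s _; rewrite mulr_ge0 // powR_ge0.
    move=> HCt; rewrite mul1r mulr1 -EFinM lee_fin.
    rewrite (_ : M * C * _ = (b - t) `^ (q - 1) * M * C); last by ring.
    apply: ler_pM => //.
    + by rewrite mulr_ge0 // powR_ge0.
    + by apply: Rintegral_ge0 => s _; rewrite mulr_ge0 // powR_ge0.
    + by apply: ler_wpM2l => //; exact: powR_ge0.
transitivity (fine (\int[mu]_t \int[mu]_s (tri a b p q f g (t, s))%:E)%E).
  rewrite Rintegral_mkcond; congr fine; apply: eq_integral => t _.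
  rewrite (tri_inner1 a b q _ _ p0 mg gM) patchE indicE.
  by case: ifPn; rewrite ?mul1r ?mul0r.
rewrite (Fubini triI) Rintegral_mkcond; congr fine; apply: eq_integral => s _.
rewrite (tri_inner2 a b _ _ p0 q0 mf fM) patchE indicE.
by case: ifPn; rewrite ?mul1r ?mul0r.
Qed.

End TriangleFubini.

(** * The Gamma function *)

Section GammaReflection.
Context {R : realType}.
Notation mu := (@lebesgue_measure R).
Implicit Types a b p q x y : R.

(** With [p + q = 1] the kernel is homogeneous of degree -1, which cancels the Jacobian [b - a]: the
    value is the same on every interval. *)
Lemma integral_beta_kernel a b p q : a < b -> p + q = 1 ->
  (\int[mu]_(t in `[a, b]) ((t - a) `^ (p - 1) * (b - t) `^ (q - 1))%:E =
   \int[mu]_(u in `[0%R, 1%R]) (u `^ (p - 1) * (1 - u) `^ (q - 1))%:E)%E.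
Proof.
move=> ab pq; have ba : 0 < b - a by rewrite subr_gt0.
have mk := measurable_beta_kernel a b (p - 1) (q - 1).
rewrite integral_itv01 //; last exact/measurable_EFinP.
rewrite -ge0_integralZl_EFin //; last 3 first.
- by move=> u _; rewrite lee_fin mulr_ge0 // powR_ge0.
- apply/measurable_EFinP; apply: measurable_funTS.
  apply: (measurableT_comp mk).
  by apply: measurable_funD => //; exact: measurable_funM.
- exact: ltW.
apply: eq_integral => u; rewrite inE /= in_itv /= => /andP[u0 u1].
rewrite -EFinM; congr EFin.
have -> : a + (b - a) * u - a = (b - a) * u by ring.
have -> : b - (a + (b - a) * u) = (b - a) * (1 - u) by ring.
rewrite !powRM ?subr_ge0 // ?(ltW ab) //.
have ba0 : b - a != 0 by rewrite gt_eqF.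
rewrite mulrACA -powRD; last by rewrite ba0 implybT.
have -> : p - 1 + (q - 1) = - 1 by rewrite -pq; ring.
by rewrite powR_inv1 ?(ltW ba) // mulVKf.
Qed.

Lemma integral_expRN :
  (\int[mu]_(s in `]0%R, +oo[) (expR (- s))%:E = 1)%E.
Proof.
rewrite integral_itv_obnd_cbnd; last first.
  apply/measurable_EFinP; apply: measurable_funTS.
  by apply: measurableT_comp => //; exact: measurable_funN.
rewrite -(integral_exponential_pdf (@ltr01 R)) [LHS]integral_mkcond.
apply: eq_integral => s _; rewrite /exponential_pdf !patchE.
by case: ifPn => // _; rewrite mul1r mulN1r.
Qed.

Lemma Gamma1 : Gamma 1 = 1 :> R.
Proof.
rewrite /Gamma /Rintegral.
under eq_integral do rewrite subrr powRr0 mul1r.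
by rewrite integral_expRN.
Qed.

(** Kept in the extended reals because [Gamma] would show a divergent integral as 0; finiteness is
    obtained in [Gamma_reflection]. *)
Let EGamma p := (\int[mu]_(s in `]0%R, +oo[) (s `^ (p - 1) * expR (- s))%:E)%E.

(* The Laplace-transform argument: substitute u = r + s in the product of the
   two integrals; the inner integral over r is then independent of u. *)
Let EGammaM p q : p + q = 1 -> (EGamma p * EGamma q =
  \int[mu]_(u in `[0%R, 1%R]) (u `^ (p - 1) * (1 - u) `^ (q - 1))%:E)%E.
Proof.
move=> pq.
pose f (z : R * R) : R := \1_`]0, +oo[ z.1 * \1_`]0, +oo[ (z.2 - z.1) *
  (z.1 `^ (p - 1) * (z.2 - z.1) `^ (q - 1) * expR (- z.2)).
have f0 z : (0 <= (f z)%:E)%E.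
  by rewrite lee_fin /f !mulr_ge0 ?powR_ge0 ?expR_ge0.
have mI (A : set R) : measurable A -> measurable_fun [set: R] (\1_A : R -> R).
  by move=> mA; exact: measurable_indic.
have mP r : measurable_fun [set: R] (fun s : R => s `^ r) by exact: measurable_powR.
have mE : measurable_fun [set: R] (fun s : R => expR (- s)).
  by apply: measurableT_comp => //; exact: measurable_funN.
have mf : measurable_fun [set: R * R] f.
  have m1 : measurable_fun [set: R * R] (fun z : R * R => z.1) by exact: measurable_fst.
  have m2 : measurable_fun [set: R * R] (fun z : R * R => z.2) by exact: measurable_snd.
  have m12 : measurable_fun [set: R * R] (fun z : R * R => z.2 - z.1).
    exact: measurable_funB.
  rewrite /f; repeat apply: measurable_funM.
  - by apply: (measurableT_comp _ m1); apply: mI.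
  - by apply: (measurableT_comp _ m12); apply: mI.
  - exact: (measurableT_comp (mP _) m1).
  - exact: (measurableT_comp (mP _) m12).
  - exact: (measurableT_comp mE m2).
have mG r : measurable_fun [set: R] (fun s : R => s `^ r * expR (- s)).
  exact: measurable_funM.
have mEf : measurable_fun [set: R * R] (EFin \o f) by exact/measurable_EFinP.
have indp x : \1_`]0, +oo[ x = (0 < x)%R%:R :> R.
  rewrite indicE; congr (_%:R); congr nat_of_bool.
  by apply/idP/idP; rewrite inE /= in_itv /= andbT.
have memp x : (x \in `]0, +oo[%classic) = (0 < x).
  by apply/idP/idP; rewrite inE /= in_itv /= andbT.
have E0 q' : (0 <= EGamma q')%E.
  by apply: integral_ge0 => s _; rewrite lee_fin mulr_ge0 ?powR_ge0 ?expR_ge0.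
transitivity (\int[mu]_r \int[mu]_u (f (r, u))%:E)%E.
  rewrite {1}/EGamma -ge0_integralZr //; last 2 first.
  - by apply/measurable_EFinP; apply: measurable_funTS; exact: mG.
  - by move=> s _; rewrite lee_fin mulr_ge0 ?powR_ge0 ?expR_ge0.
  rewrite integral_mkcond; apply: eq_integral => r _; rewrite patchE memp.
  rewrite (@integral_affine _ 1 r) ?oner_eq0 //; last first.
    exact: (measurableT_comp mEf (measurable_pair1 r)).
  rewrite normr1 mul1e /f /=.
  case: ifPn => r0; last first.
    by rewrite integral0_eq // => s _; rewrite indp (negPf r0) !mul0r.
  rewrite /EGamma -ge0_integralZl_EFin //; last 3 first.
  - by move=> s _; rewrite lee_fin mulr_ge0 ?powR_ge0 ?expR_ge0.
  - by apply/measurable_EFinP; apply: measurable_funTS; exact: mG.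
  - by rewrite mulr_ge0 ?powR_ge0 ?expR_ge0.
  rewrite integral_mkcond; apply: eq_integral => s _; rewrite patchE memp !indp r0.
  rewrite !mul1r addrK; case: ifPn => s0; last by rewrite mul0r.
  by rewrite -EFinM; congr EFin; rewrite mul1r opprD expRD; ring.
rewrite (@fubini_tonelli _ _ (measurableTypeR R) (measurableTypeR R) R mu mu (EFin \o f)) //=.
set B := (\int[mu]_(u in `[0%R, 1%R]) _)%E.
transitivity (\int[mu]_(u in `]0%R, +oo[) (B * (expR (- u))%:E))%E; last first.
  rewrite ge0_integralZl //.
  - by rewrite integral_expRN mule1.
  - by apply/measurable_EFinP; exact: measurable_funTS.
  - by apply: integral_ge0 => u _; rewrite lee_fin mulr_ge0 ?powR_ge0.
rewrite [in RHS]integral_mkcond; apply: eq_integral => u _; rewrite patchE memp.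
case: ifPn => u0; last first.
  rewrite integral0_eq // => r _; rewrite /f /= !indp subr_gt0.
  case: (ltP 0 r) => r0; last by rewrite !mul0r.
  case: (ltP r u) => ru; last by rewrite mulr0 mul0r.
  by rewrite (lt_trans r0 ru) in u0.
rewrite /B -(@integral_beta_kernel 0 u) //.
rewrite -ge0_integralZr //; last 2 first.
- apply/measurable_EFinP; apply: measurable_funTS; exact: measurable_beta_kernel.
- by move=> s _; rewrite lee_fin mulr_ge0 ?powR_ge0.
rewrite -integral_itv_obnd_cbnd; last first.
  apply/measurable_EFinP; apply: measurable_funTS.
  by apply: measurable_funM => //; exact: measurable_beta_kernel.
rewrite -integral_itv_bndo_bndc; last first.
  apply/measurable_EFinP; apply: measurable_funTS.
  by apply: measurable_funM => //; exact: measurable_beta_kernel.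
rewrite [in RHS]integral_mkcond; apply: eq_integral => r _; rewrite patchE.
rewrite (_ : (r \in `]0, u[%classic) = (0 < r) && (r < u)); last first.
  by apply/idP/idP; rewrite inE /= in_itv.
rewrite /f /= !indp subr_gt0 subr0.
case: (ltP 0 r) => r0 /=; last by rewrite !mul0r.
case: (ltP r u) => ru /=; last by rewrite mulr0 mul0r.
by rewrite !mul1r EFinM.
Qed.

(** Both exponents are negative and both bases at most 1, so each factor is at least 1. This lower
    bound rules out the degenerate value 0, both for the finiteness of the Gamma integrals and for
    their positivity. *)
Let beta01_ge1 p q : 0 < p -> 0 < q -> p + q = 1 ->
  (1 <= \int[mu]_(u in `[0%R, 1%R]) (u `^ (p - 1) * (1 - u) `^ (q - 1))%:E)%E.
Proof.
move=> p0 q0 pq.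
have p1 : p - 1 <= 0 by lra.
have q1 : q - 1 <= 0 by lra.
have ge1 r x : r <= 0 -> 0 < x <= 1 -> 1 <= x `^ r.
  move=> r0 x01; rewrite -(powRr0 x).
  exact: (ger_powR x01).
have mk : measurable_fun [set: R] (fun u => u `^ (p - 1) * (1 - u) `^ (q - 1)).
  have := measurable_beta_kernel 0 1 (p - 1) (q - 1).
  by under eq_fun do rewrite subr0.
(* The open interval is essential: at the endpoints [powR] with base 0 and a negative exponent is
   0. *)
have -> : (1 = \int[mu]_(u in `]0%R, 1%R[) 1)%E.
  by rewrite integral_cst //= lebesgue_measure_itv /= lte01 mul1e sube0.
rewrite -integral_itv_obnd_cbnd; last first.
  by apply/measurable_EFinP; apply: measurable_funTS.
rewrite -integral_itv_bndo_bndc; last first.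
  by apply/measurable_EFinP; apply: measurable_funTS.
apply: ge0_le_integral => //.
- by apply/measurable_EFinP; apply: measurable_funTS.
- move=> u /=; rewrite in_itv /= => /andP[u0 u1]; rewrite lee_fin -[leLHS]mulr1.
  by apply: ler_pM => //; apply: ge1 => //; lra.
Qed.

Lemma Gamma_reflection a b p : a < b -> 0 < p < 1 ->
  Gamma p * Gamma (1 - p) =
  \int[mu]_(t in `[a, b]) ((t - a) `^ (p - 1) * (b - t) `^ (- p)).
Proof.
move=> ab /andP[p0 p1].
have pq : p + (1 - p) = 1 by ring.
have q0 : 0 < 1 - p by lra.
have := integral_beta_kernel ab pq.
rewrite (_ : 1 - p - 1 = - p); last by ring.
have := EGammaM pq; have := beta01_ge1 p0 q0 pq.
rewrite (_ : 1 - p - 1 = - p); last by ring.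
set B := (\int[mu]_(u in `[0%R, 1%R]) _)%E => B1 GB BE.
have Bfin : B \is a fin_num.
  rewrite -BE; have h := integrable_beta_kernel ab p0 q0.
  have -> : - p = 1 - p - 1 by ring.
  exact: (integrable_fin_num _ h).
have E0 q : (0 <= EGamma q)%E.
  by apply: integral_ge0 => s _; rewrite lee_fin mulr_ge0 ?powR_ge0 ?expR_ge0.
(* An infinite factor would make the product [+oo] or, against a zero factor, 0; but [B] is finite
   and at least 1. *)
have [Ep Eq] : EGamma p \is a fin_num /\ EGamma (1 - p) \is a fin_num.
  move: GB (E0 p) (E0 (1 - p)) B1 Bfin => <-.
  case: (EGamma p) => [x| |] //; case: (EGamma (1 - p)) => [y| |] // x0 y0.
  - have := x0; rewrite lee_fin le_eqVlt => /predU1P[<-|x0']; first by rewrite mul0e lee_fin ler10.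
    by rewrite gt0_muley ?lte_fin.
  - have := y0; rewrite lee_fin le_eqVlt => /predU1P[<-|y0']; first by rewrite mule0 lee_fin ler10.
    by rewrite gt0_mulye ?lte_fin.
by rewrite /Rintegral BE -GB /Gamma /Rintegral -!/(EGamma _) fineM.
Qed.

(** Nonnegativity is immediate. A zero value, be it through divergence, would make the Beta integral
    vanish by the reflection identity, although it is at least 1. *)
Lemma Gamma_gt0 p : 0 < p <= 1 -> 0 < Gamma p.
Proof.
move=> /andP[p0]; rewrite le_eqVlt => /predU1P[->|p1]; first by rewrite Gamma1.
have G0 q : 0 <= Gamma q.
  by apply: Rintegral_ge0 => s _; rewrite mulr_ge0 ?powR_ge0 ?expR_ge0.
rewrite lt_neqAle G0 andbT eq_sym; apply/eqP => Gp.
have q0 : 0 < 1 - p by lra.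
have := @Gamma_reflection 0 1 p ltr01; rewrite Gp mul0r p0 p1 => /(_ isT).
have pq : p + (1 - p) = 1 by ring.
have := beta01_ge1 p0 q0 pq.
rewrite -(integral_beta_kernel (@ltr01 R) pq) (_ : 1 - p - 1 = - p); last by ring.
rewrite /Rintegral.
set X := (integral _ _ _)%E => X1 X0.
have Xfin : X \is a fin_num.
  have h := integrable_beta_kernel (@ltr01 R) p0 q0.
  rewrite /X (_ : - p = 1 - p - 1); last by ring.
  exact: (integrable_fin_num _ h).
by move: X1; rewrite -(fineK Xfin) -X0 lee_fin ler10.
Qed.

End GammaReflection.

(** * Continuity of fractional integrals *)

Section FractionalContinuity.
Context {R : realType}.
Notation mu := (@lebesgue_measure R).
Implicit Types (a b p q M x y t : R) (f g h : R -> R).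

(** Tietze's theorem. The global bound and continuity make substitutions and integrals over varying
    subintervals free of side conditions. *)
Lemma within_continuous_extension a b f : {within `[a, b], continuous f} ->
  exists g M, [/\ continuous g, forall x, `|g x| <= M &
    forall t, t \in `[a, b] -> g t = f t].
Proof.
move=> cf.
have [M [_ fM]] : bounded_set (f @` `[a, b]).
  by apply: compact_bounded; apply: continuous_compact => //; exact: segment_compact.
(* Boundedness only provides bounds strictly above [M], and the extension theorem asks for a
   positive one. *)
pose N := Num.max 1 (M + 1).
have N0 : 0 < N by rewrite lt_max ltr01.
have fN x : x \in `[a, b] -> `|f x| <= N.
  move=> xab; apply: fM; last by exists x.
  by rewrite lt_max ltrDl ltr01 orbT.
have clab : closed `[a, b]%classic by exact: itv_closed.
have [g [fg cg gN]] := @continuous_bounded_extension _ R (@pseudometric_normal R R) _ clab f N N0 cf fN.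
exists g, N; split => // t tab; apply/esym/fg.
by rewrite inE.
Qed.

(** Clipping the base at 0 discards the values of [powR] at negative bases, which do not join
    continuously at 0 when [p > 0]. *)
Lemma continuous_max0_powR p : 0 <= p -> continuous (fun x : R => Num.max x 0 `^ p).
Proof.
rewrite le_eqVlt => /predU1P[<- x|p0 x].
  under eq_fun do rewrite powRr0; exact: cvg_cst.
have [x0|x0|->] := ltgtP x 0.
- apply/cvgrPdist_lt => e e0; near=> y.
  rewrite !(max_idPr _) ?ltW //; first by rewrite subrr normr0.
  by near: y; exact: lt_nbhsl.
- apply/cvgrPdist_lt => e e0; near=> y.
  rewrite !(max_idPl _) ?ltW //; last by near: y; exact: lt_nbhsr.
  by near: y; move: e e0; apply/cvgrPdist_lt; exact: continuous_powR.
- apply/cvgrPdist_lt => e e0; near=> y.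
  rewrite maxxx powR0 ?gt_eqF // sub0r normrN ger0_norm ?powR_ge0 //.
  have -> : e = (e `^ p^-1) `^ p by rewrite -powRrM mulVf ?gt_eqF // powRr1 // ltW.
  apply: gt0_ltr_powR => //; rewrite ?nnegrE ?powR_ge0 ?le_max ?lexx ?orbT //.
  rewrite gt_max powR_gt0 // andbT.
  by near: y; apply: lt_nbhsl; exact: powR_gt0.
Unshelve. all: by end_near. Qed.

Lemma within_continuous_right_powR a b p : 0 <= p ->
  {within `[a, b], continuous (fun t => (b - t) `^ p)}.
Proof.
move=> p0.
have H : {within `[a, b], continuous (fun t => Num.max (b - t) 0 `^ p)}.
  apply: continuous_subspaceT => x.
  apply: (@continuous_comp _ _ _ (fun t => b - t) (fun y => Num.max y 0 `^ p)).
    by apply: cvgB; [exact: cvg_cst|exact: cvg_id].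
  exact: continuous_max0_powR.
apply: subspace_eq_continuous H => x; rewrite inE /= in_itv /= => /andP[_ xb].
by rewrite /from_subspace (max_idPl _) // subr_ge0.
Qed.

Lemma within_continuous_left_powR a b p : 0 <= p ->
  {within `[a, b], continuous (fun t => (t - a) `^ p)}.
Proof.
move=> p0.
have H : {within `[a, b], continuous (fun t => Num.max (t - a) 0 `^ p)}.
  apply: continuous_subspaceT => x.
  apply: (@continuous_comp _ _ _ (fun t => t - a) (fun y => Num.max y 0 `^ p)).
    by apply: cvgB; [exact: cvg_id|exact: cvg_cst].
  exact: continuous_max0_powR.
apply: subspace_eq_continuous H => x; rewrite inE /= in_itv /= => /andP[ax _].
by rewrite /from_subspace (max_idPl _) // subr_ge0.
Qed.

(** Dominated convergence with majorant [M * |w|]. The singular weight [w] must not depend on the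
    parameter, which is why fractional integrals are first rescaled to [[0, 1]]. *)
Lemma continuous_integral01 (w : R -> R) (h : R -> R -> R) M :
  mu.-integrable `[0, 1] (EFin \o w) ->
  (forall u, continuous (h^~ u)) ->
  (forall t, measurable_fun [set: R] (h t)) ->
  (forall t u, `|h t u| <= M) ->
  continuous (fun t => \int[mu]_(u in `[0, 1]) (w u * h t u)).
Proof.
move=> iw ch mh hM x.
have iM : mu.-integrable `[0, 1] (EFin \o (fun u => M * `|w u|)).
  apply: (integrableZl _ M (integrable_norm iw)) => //.
have mw : measurable_fun (`[0, 1]%classic : set R) w.
  by have /integrableP[/measurable_EFinP] := iw.
have bound t u : `|w u * h t u| <= M * `|w u|.
  by rewrite normrM mulrC; apply: ler_wpM2r.
apply: (@continuity_under_integral _ _ _ mu (fun t u => w u * h t u) `[0, 1]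
  _ (x - 1) (x + 1) _ _ (fun u => M * `|w u|)) => //.
- move=> t _; apply: (le_integrable _ _ _ iM) => //.
    apply/measurable_EFinP; apply: measurable_funM => //.
    by apply: measurable_funTS; exact: mh.
  move=> u _ /=; rewrite lee_fin; apply: le_trans (bound t u) (ler_norm _).
- apply: aeW => u _ t _; apply: cvgM; first exact: cvg_cst.
  exact: ch.
- by move=> t _; apply: aeW => u _; exact: bound.
- by rewrite inE /= in_itv /= ltrBlDr ltrDl ltr01.
Qed.

Lemma measurable_comp_affine g x y : measurable_fun [set: R] g ->
  measurable_fun [set: R] (fun u => g (x + y * u)).
Proof.
move=> mg; apply: (measurableT_comp mg).
by apply: measurable_funD => //; exact: measurable_funM.
Qed.

(** The moving singularity at [s = t] becomes a fixed one at [u = 1], at the price of the factor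
    [(t - a)^p], continuous since [p > 0]. At [t = a] both sides are 0. *)
Lemma left_integral01 a p M g t : 0 < p -> a <= t ->
  measurable_fun [set: R] g -> (forall x, `|g x| <= M) ->
  \int[mu]_(s in `[a, t]) ((t - s) `^ (p - 1) * g s) =
  (t - a) `^ p * \int[mu]_(u in `[0, 1]) ((1 - u) `^ (p - 1) * g (a + (t - a) * u)).
Proof.
move=> p0; rewrite le_eqVlt => /predU1P[<- mg gM|at_ mg gM].
  by rewrite set_itv1 Rintegral_set1 subrr powR0 ?mul0r // gt_eqF.
have ta : 0 <= t - a by rewrite subr_ge0 ltW.
have mk : measurable_fun [set: R] (fun s => (t - s) `^ (p - 1) * g s).
  apply: measurable_funM => //.
  by apply: (measurableT_comp (measurable_powR (p - 1))); exact: measurable_funB.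
rewrite Rintegral_itv01 // -mulr_powRB1 // -mulrA; congr (_ * _).
rewrite -RintegralZl //; last first.
  apply: (integrable_left_kernelM (M := M) ler01 p0) => //.
  exact: measurable_comp_affine.
apply: eq_Rintegral => u; rewrite inE /= in_itv /= => /andP[u0 u1].
have u1' : 0 <= 1 - u by rewrite subr_ge0.
by rewrite mulrA -powRM //; congr (_ `^ _ * _); ring.
Qed.

(* Rescaling to [0, 1] isolates the singularity at [b] in a power of [b - t];
   the remaining factor is continuous up to [t = b]. *)
Lemma right_integral01 b p q M f t : 0 < p -> 0 < q -> t < b ->
  measurable_fun [set: R] f -> (forall x, `|f x| <= M) ->
  \int[mu]_(s in `[t, b]) ((s - t) `^ (p - 1) * ((b - s) `^ (q - 1) * f s)) =
  (b - t) `^ (p + q - 1) * \int[mu]_(u in `[0, 1])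
    (u `^ (p - 1) * (1 - u) `^ (q - 1) * f (t + (b - t) * u)).
Proof.
move=> p0 q0 tb mf fM.
have bt0 : 0 < b - t by rewrite subr_gt0.
have bt : 0 <= b - t by rewrite ltW.
rewrite Rintegral_itv01 //; last first.
  rewrite [X in measurable_fun _ X](_ : _ = fun s : R =>
    ((s - t) `^ (p - 1) * (b - s) `^ (q - 1)) * f s); last first.
    by apply/funext => s; rewrite mulrA.
  by apply: measurable_funM => //; exact: measurable_beta_kernel.
have btn0 : b - t != 0 by rewrite gt_eqF.
have -> : (b - t) `^ (p + q - 1) = (b - t) * ((b - t) `^ (p - 1) * (b - t) `^ (q - 1)).
  rewrite -{2}(powRr1 bt) -!powRD ?btn0 ?implybT //.
  by congr (_ `^ _); ring.
rewrite -mulrA; congr (_ * _).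
rewrite -RintegralZl //; last first.
  apply: eq_integrable (integrable_kernelM ler01 p0 q0
    (measurable_comp_affine t (b - t) mf) (fun=> fM _)) => //.
  by move=> u _; rewrite subr0 mulrA.
apply: eq_Rintegral => u; rewrite inE /= in_itv /= => /andP[u0 u1].
have u1' : 0 <= 1 - u by rewrite subr_ge0.
have -> : t + (b - t) * u - t = (b - t) * u by ring.
have -> : b - (t + (b - t) * u) = (b - t) * (1 - u) by ring.
by rewrite !powRM //; ring.
Qed.

Lemma continuous_beta_integral b p q M f : 0 < p -> 0 < q ->
  continuous f -> (forall x, `|f x| <= M) ->
  continuous (fun t => \int[mu]_(u in `[0, 1])
    (u `^ (p - 1) * (1 - u) `^ (q - 1) * f (t + (b - t) * u))).
Proof.
move=> p0 q0 cf fM; apply: (@continuous_integral01 _ _ M) => //.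
- exact: integrable_beta.
- move=> u t; apply: (@continuous_comp _ _ _ (fun t => t + (b - t) * u) f); last exact: cf.
  apply: cvgD; first exact: cvg_id.
  apply: cvgM; last exact: cvg_cst.
  by apply: cvgB; [exact: cvg_cst|exact: cvg_id].
- move=> t; apply: measurable_comp_affine.
  exact: continuous_measurable_fun.
Qed.

Lemma within_continuous_left_integral a b p M g : 0 < p ->
  continuous g -> (forall x, `|g x| <= M) ->
  {within `[a, b], continuous
    (fun t => \int[mu]_(s in `[a, t]) ((t - s) `^ (p - 1) * g s))}.
Proof.
move=> p0 cg gM.
have mg : measurable_fun [set: R] g by exact: continuous_measurable_fun.
pose K t := \int[mu]_(u in `[0, 1]) ((1 - u) `^ (p - 1) * g (a + (t - a) * u)).
have cK : continuous K.
  apply: (@continuous_integral01 _ _ M) => //.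
  - apply: eq_integrable (integrable_beta ltr01 p0) => //.
    by move=> u _; rewrite subrr powRr0 mul1r.
  - move=> u t; apply: (@continuous_comp _ _ _ (fun t => a + (t - a) * u) g); last exact: cg.
    apply: cvgD; first exact: cvg_cst.
    apply: cvgM; last exact: cvg_cst.
    by apply: cvgB; [exact: cvg_id|exact: cvg_cst].
  - by move=> t; exact: measurable_comp_affine.
have H : {within `[a, b], continuous (fun t => (t - a) `^ p * K t)}.
  move=> x; apply: cvgM.
    exact: (within_continuous_left_powR (ltW p0)).
  exact: (continuous_subspaceT cK).
apply: subspace_eq_continuous H => x; rewrite inE /= in_itv /= => /andP[ax _].
by rewrite /from_subspace (left_integral01 p0 ax mg gM).
Qed.

End FractionalContinuity.

(** * The Caputo derivative *)

Section CaputoDerivative.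
Context {R : realType}.
Notation mu := (@lebesgue_measure R).
Implicit Types (a b p q M x y t s : R) (f g h : R -> R).

(** Dirichlet's formula, with the constant [(Gamma p)^-1] as [f], leaves an inner integral which by
    [Gamma_reflection] has the same value for all [s < b]. *)
Lemma fractional_semigroup a b p M g : 0 < p < 1 -> continuous g ->
  (forall x, `|g x| <= M) ->
  (Gamma (1 - p))^-1 * \int[mu]_(t in `[a, b]) ((b - t) `^ (1 - p - 1) *
     ((Gamma p)^-1 * \int[mu]_(s in `[a, t]) ((t - s) `^ (p - 1) * g s))) =
  \int[mu]_(s in `[a, b]) g s.
Proof.
move=> p01 cg gM; have /andP[p0 p1] := p01.
have mg : measurable_fun [set: R] g by exact: continuous_measurable_fun.
have q0 : 0 < 1 - p by rewrite subr_gt0.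
have Gp : Gamma p != 0 by rewrite gt_eqF // Gamma_gt0 // p0 ltW.
have Gq : Gamma (1 - p) != 0 by rewrite gt_eqF // Gamma_gt0 // q0; lra.
have [ab|ba] := leP a b; last first.
  by rewrite !set_itv_ge ?bnd_simp -?ltNge // !Rintegral_set0 mulr0.
pose k : R := (Gamma p)^-1.
pose N := Num.max M `|k|.
have gN x : `|g x| <= N by rewrite le_max gM.
have kN x : `|cst k x : R| <= N by rewrite le_max lexx orbT.
have TF := @triangle_Fubini _ a b p (1 - p) N (cst k) g p0 q0 (measurable_cst _) kN mg gN.
have -> : \int[mu]_(s in `[a, b]) g s =
    (Gamma (1 - p))^-1 * \int[mu]_(s in `[a, b]) (Gamma (1 - p) * g s).
  rewrite RintegralZl ?mulKf //.
  by apply: continuous_compact_integrable; [exact: segment_compact|exact: continuous_subspaceT].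
congr (_ * _).
rewrite [LHS](_ : _ = \int[mu]_(t in `[a, b]) ((b - t) `^ (1 - p - 1) * cst k t *
   \int[mu]_(s in `[a, t]) ((t - s) `^ (p - 1) * g s))); last first.
  by apply: eq_Rintegral => t _; rewrite mulrA.
rewrite TF /Rintegral.
(* At [s = b] the inner integral runs over a point and is 0, so the identity is proved, and then
   integrated, on [[a, b[]. *)
have inner s : s \in `[a, b[%classic -> g s *
    \int[mu]_(t in `[s, b]) ((t - s) `^ (p - 1) * ((b - t) `^ (1 - p - 1) * cst k t)) =
    Gamma (1 - p) * g s.
  rewrite inE /= in_itv /= => /andP[_ sb].
  rewrite [X in _ * X](_ : _ = (Gamma p * Gamma (1 - p)) * k).
    by rewrite /k; field.
  rewrite (Gamma_reflection sb p01) -RintegralZr //.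
    by apply: eq_Rintegral => t _; rewrite mulrA; congr (_ * _ `^ _ * _); ring.
  have -> : - p = 1 - p - 1 by ring.
  exact: integrable_beta_kernel.
have mc : measurable_fun `[a, b[ (fun s => (Gamma (1 - p) * g s)%:E).
  by apply/measurable_EFinP; apply: measurable_funTS; exact: measurable_funM.
rewrite -integral_itv_bndo_bndc; last first.
  apply: eq_measurable_fun mc => s sab.
  by rewrite -inner.
rewrite -[in RHS]integral_itv_bndo_bndc //.
by congr fine; apply: eq_integral => s sab; rewrite -inner.
Qed.

Lemma integrable_left_kernel_continuous a b q h : a <= b -> 0 < q ->
  {within `[a, b], continuous h} ->
  mu.-integrable `[a, b] (fun t => ((b - t) `^ (q - 1) * h t)%:E).
Proof.
move=> ab q0 /within_continuous_extension[g [M [cg gM gh]]].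
have mg : measurable_fun [set: R] g by exact: continuous_measurable_fun.
apply: eq_integrable (integrable_left_kernelM ab q0 mg gM) => //.
by move=> t; rewrite inE /= => tab; rewrite gh.
Qed.

(** Starting the primitive at [a - 1] makes every [t] in [[a, b]] an interior point, so the
    two-sided fundamental theorem covers the endpoints too; restricting the increments to [[a, b]]
    only refines the filter. *)
Lemma cvg_difference_quotient_integral a b t M g : a < b -> t \in `[a, b] ->
  continuous g -> (forall x, `|g x| <= M) ->
  (fun s => (s - t)^-1 * (\int[mu]_(x in `[a, s]) g x - \int[mu]_(x in `[a, t]) g x))
    @ within `[a, b] t^' --> g t.
Proof.
move=> ab tab cg gM; have /andP[at_ tb] : a <= t <= b by move: tab; rewrite in_itv.
have ig c d : mu.-integrable `[c, d] (EFin \o g).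
  by apply: continuous_compact_integrable; [exact: segment_compact|exact: continuous_subspaceT].
pose F x := \int[mu]_(y in `[a - 1, x]) g y.
have a1 : a - 1 < t by apply: lt_le_trans at_; rewrite gtrBl.
have b1 : t < b + 1 by apply: le_lt_trans tb _; rewrite ltrDl.
have [dF F'] := @continuous_FTC1_closed _ g (a - 1) t (b + 1) b1 (ig _ _) a1 (cg t).
have FE s : a <= s -> \int[mu]_(x in `[a, s]) g x = F s - F a.
  move=> as_.
  have h1 : (BLeft (a - 1) <= BRight a)%O by rewrite bnd_simp; lra.
  have h2 : (BRight a <= BRight s)%O by rewrite bnd_simp.
  rewrite /F (Rintegral_itvB (ig _ _) h1 h2).
  rewrite Rintegral_itv_obnd_cbnd //.
  by apply: integrableS (ig a s) => //; exact: subset_itv_oc_cc.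
apply/cvgrPdist_lt => e e0.
have /cvgrPdist_lt /(_ e e0) : (fun z => z^-1 *: (F (z + t) - F t)) @ 0^' --> g t.
  rewrite -F'; move: dF; rewrite /derivable /derive1.
  rewrite (_ : (fun z => z^-1 *: _) = (fun z => z^-1 *: (F (z + t) - F t))) //.
  by apply/funext => z; rewrite /= [z *: 1]mulr1.
rewrite /= -!nbhs_nearE /dnbhs => H.
have {H} [d /= d0 H] := H.
exists d => //= s sd st sab.
have sa : a <= s by move: sab; rewrite /= in_itv /= => /andP[].
rewrite (FE s sa) (FE t at_) opprB addrA subrK.
have := H (s - t); rewrite /ball_ /= sub0r normrN -normrN opprB => /(_ sd).
by rewrite subr_eq0 subrK; apply.
Qed.

(** [derive_on] is a [lim], and a convergence determines it only along a proper filter. Nearby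
    points are taken to the right of [t], or to the left when [t = b]. *)
Lemma within_dnbhs_proper a b t : a < b -> t \in `[a, b] ->
  ProperFilter (within `[a, b]%classic t^').
Proof.
move=> ab; rewrite in_itv /= => /andP[at_ tb].
apply: Build_ProperFilter_ex => P [d /= d0 H].
move: tb; rewrite le_eqVlt => /predU1P[tb|tb].
- exists (Num.max a (t - d / 2)); apply: H => /=.
  + rewrite /ball_ /= ger0_norm; last by rewrite subr_ge0 ge_max at_; lra.
    by rewrite ltrBlDr -ltrBlDl lt_max; apply/orP; right; lra.
  + by rewrite lt_eqF // gt_max; apply/andP; split; lra.
  + by rewrite in_itv /= le_max lexx ge_max; apply/andP; split; lra.
- exists (Num.min b (t + d / 2)); apply: H => /=.
  + rewrite /ball_ /= ler0_norm; last by rewrite subr_le0 le_min (ltW tb); lra.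
    by rewrite opprB ltrBlDr gt_min; apply/orP; right; lra.
  + by rewrite gt_eqF // lt_min tb; lra.
  + rewrite in_itv /= ge_min lexx /= andbT le_min (ltW ab) /=; lra.
Qed.

(** * Vector-valued functions, coordinate by coordinate *)

Section Vector.
Context {n : nat}.
Implicit Types phi psi : R -> 'rV[R]_n.

Lemma cvg_row (T : Type) (F : set_system T) {FF : Filter F} (f : T -> 'rV[R]_n)
    (l : 'rV[R]_n) :
  (forall i, (fun x : T => f x ord0 i) @ F --> l ord0 i) -> f @ F --> l.
Proof.
move=> H A [P lP sPA].
have : \forall x \near F, forall i : 'I_n, P ord0 i (f x ord0 i).
  by apply: filter_forall => i; apply: H; exact: lP.
by apply: filterS => x Px; apply: sPA => j i; rewrite (ord1 j).
Qed.

Lemma within_continuous_coord (T : topologicalType) (A : set T)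
    (psi : T -> 'rV[R]_n) i : {within A, continuous psi} ->
  {within A, continuous (fun t : T => psi t ord0 i)}.
Proof.
move=> cpsi x.
apply: (@cvg_comp _ _ _ (psi : subspace A -> _) (fun v : 'rV[R]_n => v ord0 i) _ _ _ (cpsi x)).
exact: coord_continuous.
Qed.

Lemma within_continuous_row (T : topologicalType) (A : set T)
    (psi : T -> 'rV[R]_n) :
  (forall i, {within A, continuous (fun t : T => psi t ord0 i)}) ->
  {within A, continuous psi}.
Proof. by move=> H x; apply: cvg_row => i; exact: H. Qed.

Lemma RLleftE t0 a psi t i : a != 0 -> RLleft t0 a psi t ord0 i =
  (Gamma a)^-1 * \int[mu]_(s in `[t0, t]) ((t - s) `^ (a - 1) * psi s ord0 i).
Proof.
move=> /negPf a0; rewrite /RLleft a0 !mxE; congr (_ * _).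
by apply: eq_Rintegral => s _; rewrite mxE.
Qed.

Lemma RLrightE t1 a psi t i : RLright t1 a psi t ord0 i =
  (Gamma a)^-1 * \int[mu]_(s in `[t, t1]) ((s - t) `^ (a - 1) * psi s ord0 i).
Proof.
rewrite /RLright !mxE; congr (_ * _).
by apply: eq_Rintegral => s _; rewrite mxE.
Qed.

(** The semigroup law turns the function that [Caputo] differentiates into the plain primitive of
    [psi]. Order [a = 1] is separate: [RLleft] of order 0 is the identity by definition, and
    [Gamma 1 = 1]. *)
Lemma CaputoE t0 t1 a phi psi : t0 < t1 -> 0 < a <= 1 ->
  {within `[t0, t1], continuous psi} ->
  (forall t, t \in `[t0, t1] -> phi t = phi t0 + RLleft t0 a psi t) ->
  forall t, t \in `[t0, t1] -> Caputo t0 t1 a phi t = psi t.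
Proof.
move=> t01 /andP[a0 a1] cpsi phiE t tab.
have PF := within_dnbhs_proper t01 tab.
apply: cvg_lim; first exact: norm_hausdorff.
apply: cvg_row => i.
have [g [M [cg gM gpsi]]] := within_continuous_extension (within_continuous_coord (i := i) cpsi).
have sub s r : s \in `[t0, t1] -> r \in `[t0, s] -> r \in `[t0, t1].
  by rewrite !in_itv /= => /andP[_ st] /andP[-> rs]; exact: le_trans rs st.
have RLi r : r \in `[t0, t1] -> (phi r - phi t0) ord0 i =
   (Gamma a)^-1 * \int[mu]_(s in `[t0, r]) ((r - s) `^ (a - 1) * g s).
  move=> rt; rewrite phiE // addrAC subrr add0r RLleftE ?gt_eqF //; congr (_ * _).
  apply: eq_Rintegral => s; rewrite inE /= => sr.
  by rewrite gpsi //; exact: sub rt sr.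
have key s : s \in `[t0, t1] ->
    RLleft t0 (1 - a) (fun s => phi s - phi t0) s ord0 i = \int[mu]_(x in `[t0, s]) g x.
  move=> st; move: (a1); rewrite le_eqVlt => /predU1P[a1'|a1'].
    rewrite /RLleft a1' subrr eqxx RLi // a1' Gamma1 invr1 mul1r.
    by apply: eq_Rintegral => r _; rewrite subrr powRr0 mul1r.
  rewrite RLleftE; last by rewrite subr_eq0 gt_eqF.
  rewrite -(@fractional_semigroup t0 s a M g) ?a0 //; congr (_ * _).
  by apply: eq_Rintegral => r; rewrite inE /= => rs; rewrite RLi //; exact: sub st rs.
have H := cvg_difference_quotient_integral t01 tab cg gM.
rewrite -(gpsi _ tab); apply: cvg_trans H.
apply: near_eq_cvg; rewrite near_withinE; near=> s => st.
by rewrite !mxE !key.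
Unshelve. all: by end_near. Qed.

Lemma Calpha_continuous t0 t1 a phi : 0 < a -> Calpha t0 t1 a phi ->
  {within `[t0, t1], continuous phi}.
Proof.
move=> a0 [psi [cpsi phiE]]; apply: within_continuous_row => i.
have [g [M [cg gM gpsi]]] := within_continuous_extension (within_continuous_coord (i := i) cpsi).
have H : {within `[t0, t1], continuous (fun t => phi t0 ord0 i +
    (Gamma a)^-1 * \int[mu]_(s in `[t0, t]) ((t - s) `^ (a - 1) * g s))}.
  move=> x; apply: cvgD; first exact: cvg_cst.
  apply: cvgM; first exact: cvg_cst.
  exact: (within_continuous_left_integral a0 cg gM).
apply: subspace_eq_continuous H => t; rewrite inE /= => tt.
rewrite /from_subspace (phiE _ tt) mxE RLleftE ?gt_eqF //; congr (_ + _ * _).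
apply: eq_Rintegral => s; rewrite inE /= => st; rewrite gpsi //.
by move: tt st; rewrite !in_itv /= => /andP[_ tt] /andP[-> st]; exact: le_trans st tt.
Qed.

End Vector.
End CaputoDerivative.

(** * Uniform expansion along a graph *)

Section DirectionalCalculus.
Context {R : realType}.

(** Fermat's rule: testing at [m] and [-m] for small [m > 0] shows that neither [D] nor [-D] is
    negative. *)
Lemma critical_difference_quotient (Phi : R -> R) (D : R) :
  (fun e => e^-1 * (Phi e - Phi 0)) @ 0^' --> D ->
  (\forall e \near 0, Phi 0 <= Phi e) -> D = 0.
Proof.
move=> cD [d /= d0 Hmin].
have key (D' : R) (s : R) : `|s| = 1 -> (fun e => e^-1 * (Phi e - Phi 0)) @ 0^' --> D' ->
    0 <= s * D'.
  move=> s1 /cvgrPdist_lt cD'; rewrite leNgt; apply/negP => D0.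
  have D0' : 0 < - (s * D') by rewrite oppr_gt0.
  have [d' /= d'0 H] := cD' _ D0'.
  pose m := Num.min d d' / 2.
  have m0 : 0 < m by rewrite divr_gt0 // lt_min d0.
  have [md md'] : m < d /\ m < d'.
    have : Num.min d d' <= d by rewrite ge_min lexx.
    have : Num.min d d' <= d' by rewrite ge_min lexx orbT.
    by rewrite /m; split; lra.
  have sn0 : s != 0 by rewrite -normr_gt0 s1.
  have nsm : `|s * m| = m by rewrite normrM s1 mul1r gtr0_norm.
  have h1 : Phi 0 <= Phi (s * m) by apply: Hmin; rewrite /ball_ /= sub0r normrN nsm.
  have := H (s * m); rewrite /ball_ /= sub0r normrN nsm mulf_neq0 ?sn0 ?(gt_eqF m0) // => /(_ md' isT).
  have X0 : 0 <= m^-1 * (Phi (s * m) - Phi 0).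
    by rewrite mulr_ge0 ?subr_ge0 // ltW // invr_gt0.
  rewrite invfM -mulrA; move: X0; set X := m^-1 * _ => X0.
  rewrite ltr_norml => /andP[].
  have /orP[/eqP ->|/eqP ->] : (s == 1) || (s == -1).
    by have := eqr_norml s 1; rewrite s1 eqxx ler01 andbT => <-.
  - rewrite invr1 !mul1r; lra.
  - rewrite invrN1 !mulN1r; lra.
have := key D 1 (normr1 _) cD; have := key D (-1) _ cD.
rewrite normrN normr1 mul1r mulN1r => /(_ erefl); lra.
Qed.

(** Stated with [|s| <= |a|] so that increments of either sign, and the zero increment, need no case
    distinction later. *)
Lemma MVT_from0 (k k' : R -> R) (a : R) :
  (forall s : R, `|s| <= `|a| -> is_derive s 1 k (k' s)) ->
  exists2 s : R, `|s| <= `|a| & k a - k 0 = k' s * a.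
Proof.
move=> dk.
have ck s : `|s| <= `|a| -> {for s, continuous k}.
  by move=> sa; apply: differentiable_continuous; apply/derivable1_diffP; have [] := dk _ sa.
have [a0|a0|a0] := ltgtP a 0.
- have na : `|a| = - a by rewrite ltr0_norm.
  have sub x : x \in `[a, 0] -> `|x| <= `|a|.
    by rewrite in_itv /= na => /andP[? ?]; rewrite ler0_norm // lerN2.
  have [] := @MVT R k k' a 0 a0.
  + by move=> x xa; apply: dk; apply: sub; exact: subset_itv_oo_cc.
  + by apply: continuous_in_subspaceT => x; rewrite inE => xa; apply: ck; exact: sub.
  + move=> s sa E; exists s; first by apply: sub; exact: subset_itv_oo_cc.
    by move: E; rewrite sub0r mulrN => E; rewrite -[LHS]opprB E opprK.
- have na : `|a| = a by rewrite gtr0_norm.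
  have sub x : x \in `[0, a] -> `|x| <= `|a|.
    by rewrite in_itv /= na => /andP[? ?]; rewrite ger0_norm.
  have [] := @MVT R k k' 0 a a0.
  + by move=> x xa; apply: dk; apply: sub; exact: subset_itv_oo_cc.
  + by apply: continuous_in_subspaceT => x; rewrite inE => xa; apply: ck; exact: sub.
  + move=> s sa E; exists s; first by apply: sub; exact: subset_itv_oo_cc.
    by rewrite E subr0.
- by exists 0; rewrite a0 ?normr0 // subrr mulr0.
Qed.

Lemma is_derive_line (V : normedModType R) (f : V -> R) (p v : V) (s : R) :
  derivable f (p + s *: v) v ->
  is_derive s 1 (fun r : R => f (p + r *: v)) ('D_v f (p + s *: v)).
Proof.
move=> df.
have E : (fun h : R => h^-1 *: (((fun r : R => f (p + r *: v)) \o shift s) (h *: 1) - f (p + s *: v)))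
   = (fun h : R => h^-1 *: ((f \o shift (p + s *: v)) (h *: v) - f (p + s *: v))).
  apply/funext => h; rewrite /= [h *: 1]mulr1; congr (_ *: (f _ - _)).
  by rewrite scalerDl addrCA.
apply: DeriveDef; first by rewrite /derivable E; exact: df.
by rewrite /derive E.
Qed.

End DirectionalCalculus.

(** * Compactness along the graph *)

Section GraphNeighborhood.
Context {R : realType} {n : nat}.
Variables (t0 t1 : R) (U : set (R * 'rV[R]_n * 'rV[R]_n)).
Hypothesis oU : open U.
Notation A := (U `&` [set p | p.1.1 \in `[t0, t1]]).

Lemma within_continuous_graph (F : R * 'rV[R]_n * 'rV[R]_n -> R)
    (x y : R -> 'rV[R]_n) :
  {within A, continuous F} ->
  {within `[t0, t1], continuous x} -> {within `[t0, t1], continuous y} ->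
  (forall t, t \in `[t0, t1] -> U (t, x t, y t)) ->
  {within `[t0, t1], continuous (fun t => F (t, x t, y t))}.
Proof.
move=> /subspace_continuousP cF /subspace_continuousP cx /subspace_continuousP cy gU.
apply/subspace_continuousP => t tab.
have At : A (t, x t, y t) by split => //=; exact: gU.
have cG : (fun t => (t, x t, y t)) @ within `[t0, t1]%classic (nbhs t) -->
    (t, x t, y t).
  apply: (@cvg_pair _ _ _ _ (nbhs (t, x t)) (nbhs (y t)) _ _ _
    (fun t => (t, x t)) y); last exact: cy.
  apply: (@cvg_pair _ _ _ _ (nbhs t) (nbhs (x t)) _ _ _ id x); last exact: cx.
  exact: cvg_within.
apply: cvg_comp (cF _ At) => P HP.
apply: (@filterS _ (nbhs t) _ _ _ _ (cG _ HP)) => s Hs sab.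
by apply: Hs => //; split => //=; exact: gU.
Qed.

(** Tube lemma and uniform continuity in one: near each [t] a small radius works for all
    neighbouring times, and compactness of [[t0, t1]], in near-covering form, makes it uniform. *)
Lemma graph_uniform (F : R * 'rV[R]_n * 'rV[R]_n -> R) (x y : R -> 'rV[R]_n) :
  {within A, continuous F} ->
  {within `[t0, t1], continuous x} -> {within `[t0, t1], continuous y} ->
  (forall t, t \in `[t0, t1] -> U (t, x t, y t)) ->
  forall eta : R, 0 < eta -> exists2 d : R, 0 < d & forall t, t \in `[t0, t1] ->
    forall u v : 'rV[R]_n, `|u - x t| < d -> `|v - y t| < d ->
    U (t, u, v) /\ `|F (t, u, v) - F (t, x t, y t)| < eta.
Proof.
move=> /subspace_continuousP cF /subspace_continuousP cx /subspace_continuousP cy gU.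
move=> eta eta0.
have K : near_covering_within (`[t0, t1]%classic : set R).
  by apply/near_covering_withinP/compact_near_coveringP; exact: segment_compact.
pose P (d t : R) := forall u v : 'rV[R]_n, `|u - x t| < d -> `|v - y t| < d ->
    U (t, u, v) /\ `|F (t, u, v) - F (t, x t, y t)| < eta.
have : \forall d \near (0 : R)^'+, `[t0, t1] `<=` P d.
  apply: K => t tab.
  have At : A (t, x t, y t) by split => //=; exact: gU.
  (* The values at [(s, u, v)] and at [(s, x s, y s)] are both compared with the one at
     [(t, x t, y t)]. Likewise [r / 2] below is allotted once to the motion of the graph from [t] to
     [s] and once to the displacement of [(u, v)]. *)
  have eta2 : 0 < eta / 2 by rewrite divr_gt0.
  have /cvgrPdist_lt /(_ _ eta2)/nbhs_ballP[r1 /= r10 H1] := cF _ At.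
  have /nbhs_ballP[r2 /= r20 H2] : nbhs (t, x t, y t) U.
    by apply: open_nbhs_nbhs; split => //; exact: gU.
  have [r [r0 rr1 rr2]] : exists r : R, [/\ 0 < r, r <= r1 & r <= r2].
    by exists (Num.min r1 r2); rewrite lt_min r10 r20 !ge_min !lexx orbT.
  have r2' : 0 < r / 2 by rewrite divr_gt0.
  have /cvgrPdist_lt /(_ _ r2')[s1 /= s10 Hx] := cx _ tab.
  have /cvgrPdist_lt /(_ _ r2')[s2 /= s20 Hy] := cy _ tab.
  exists (ball t (Num.min r (Num.min s1 s2)), `]0, (r / 2)]%classic); first split => /=.
  - by apply: nbhsx_ballx; rewrite !lt_min r0 s10 s20.
  - by near=> d => /=; rewrite in_itv /=; apply/andP; split; near: d;
      [exact: nbhs_right_gt|exact: nbhs_right_le].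
  - move=> [s d] /=; rewrite in_itv /= => -[ts /andP[d0 dr]] sab u v us vs.
    have : ball t (Num.min r (Num.min s1 s2)) s := ts.
    rewrite -ball_normE /= !lt_min => /and3P[tsr ts1 ts2].
    have xs : `|x t - x s| < r / 2 by apply: Hx => //; rewrite -ball_normE.
    have ys : `|y t - y s| < r / 2 by apply: Hy => //; rewrite -ball_normE.
    have near1 u' v' : `|u' - x s| < d -> `|v' - y s| < d ->
        ball (t, x t, y t) r (s, u', v').
      move=> hu hv; split; first split => /=.
      + by rewrite -ball_normE.
      + rewrite -ball_normE /=.
        rewrite (_ : x t - u' = (x t - x s) - (u' - x s)); last by rewrite opprB addrA subrK.
        by apply: le_lt_trans (ler_normB _ _) _; lra.
      + rewrite -ball_normE /=.
        rewrite (_ : y t - v' = (y t - y s) - (v' - y s)); last by rewrite opprB addrA subrK.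
        by apply: le_lt_trans (ler_normB _ _) _; lra.
    have b1 := near1 _ _ us vs.
    have b2 : ball (t, x t, y t) r (s, x s, y s) by apply: near1; rewrite subrr normr0.
    have Us : U (s, u, v) by apply: H2; exact: le_ball b1.
    split => //.
    have h1 : `|F (t, x t, y t) - F (s, u, v)| < eta / 2.
      by apply: H1; [exact: le_ball b1|split].
    have h2 : `|F (t, x t, y t) - F (s, x s, y s)| < eta / 2.
      by apply: H1; [exact: le_ball b2|split => //=; exact: gU].
    rewrite (_ : _ - _ = (F (t, x t, y t) - F (s, x s, y s)) -
       (F (t, x t, y t) - F (s, u, v))); last by ring.
    by apply: le_lt_trans (ler_normB _ _) _; lra.
move=> H.
have : \forall d \near (0 : R)^'+, 0 < d /\ `[t0, t1] `<=` P d.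
  by near=> d; split; near: d => //; exact: nbhs_right_gt.
by move=> /filter_ex[d [d0 Hd]]; exists d => // t tab; exact: Hd.
Unshelve. all: by end_near. Qed.

End GraphNeighborhood.

(** * First-order expansions of the integrand and of the endpoint term *)

Section Expansions.
Context {R : realType} {n : nat}.
Notation V := 'rV[R]_n.

Lemma normr_scale_delta (a : R) (i : 'I_n) :
  `|a *: (delta_mx ord0 i : V)| <= `|a|.
Proof.
rewrite normrZ -[leRHS]mulr1; apply: ler_wpM2l => //.
rewrite -[leLHS]/(mx_norm _) mx_normrE; apply/bigmax_leP; split => // -[j k] _ /=.
by rewrite mxE; case: (_ && _); rewrite ?normr1 ?normr0.
Qed.

Lemma gradientE (f : V -> R) (x : V) i : gradient f x ord0 i = 'D_(delta_mx ord0 i) f x.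
Proof. by rewrite mxE. Qed.

(* Only the coordinate [i] moves, so continuity of the partial derivatives is
   enough: one mean value step in [x_i], then one in [y_i]. *)
Lemma graph_expansion (t0 t1 : R) (L : R -> V -> V -> R) (x y : R -> V)
    (U : set (R * V * V)) (i : 'I_n) :
  let A := U `&` [set p | p.1.1 \in `[t0, t1]] in
  open U -> (forall t, t \in `[t0, t1] -> U (t, x t, y t)) ->
  (forall p, A p -> has_gradient (fun u => L p.1.1 u p.2) p.1.2 /\
                    has_gradient (fun v => L p.1.1 p.1.2 v) p.2) ->
  {within A, continuous (fun p => gradient (fun u => L p.1.1 u p.2) p.1.2)} ->
  {within A, continuous (fun p => gradient (fun v => L p.1.1 p.1.2 v) p.2)} ->
  {within `[t0, t1], continuous x} -> {within `[t0, t1], continuous y} ->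
  forall eta : R, 0 < eta -> exists2 d : R, 0 < d & forall t, t \in `[t0, t1] ->
    forall a b : R, `|a| < d -> `|b| < d ->
    U (t, x t + a *: delta_mx ord0 i, y t + b *: delta_mx ord0 i) /\
    `|L t (x t + a *: delta_mx ord0 i) (y t + b *: delta_mx ord0 i)
      - L t (x t) (y t)
      - (a * gradient (fun u => L t u (y t)) (x t) ord0 i +
         b * gradient (fun v => L t (x t) v) (y t) ord0 i)|
    <= eta * (`|a| + `|b|).
Proof.
move=> A oU gU hg cLx cLy cx cy eta eta0.
set e := delta_mx ord0 i.
have [d1 d10 H1] := graph_uniform oU (within_continuous_coord (i := i) cLx) cx cy gU eta0.
have [d2 d20 H2] := graph_uniform oU (within_continuous_coord (i := i) cLy) cx cy gU eta0.
exists (Num.min d1 d2); first by rewrite lt_min d10.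
move=> t tab a b; rewrite !lt_min => /andP[a1 a2] /andP[b1 b2].
have small d (u : V) (s r : R) : `|s| <= `|r| -> `|r| < d -> `|u + s *: e - u| < d.
  move=> sr rd; rewrite addrAC subrr add0r.
  by apply: le_lt_trans (normr_scale_delta s i) _; exact: le_lt_trans sr rd.
have [Uab _] := H1 t tab _ _ (small _ (x t) _ _ (lexx _) a1) (small _ (y t) _ _ (lexx _) b1).
split => //.
have [s sa Es] : exists2 s : R, `|s| <= `|a| &
    L t (x t + a *: e) (y t + b *: e) - L t (x t) (y t + b *: e) =
    gradient (fun u => L t u (y t + b *: e)) (x t + s *: e) ord0 i * a.
  have [|s sa E] := @MVT_from0 R (fun r => L t (x t + r *: e) (y t + b *: e))
    (fun r => gradient (fun u => L t u (y t + b *: e)) (x t + r *: e) ord0 i) a.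
    move=> s sa; rewrite gradientE.
    apply: (@is_derive_line R V (fun u => L t u (y t + b *: e))).
    have [Us _] := H1 t tab _ _ (small _ (x t) _ _ sa a1) (small _ (y t) _ _ (lexx _) b1).
    by have [/(_ i) + _] := hg (t, x t + s *: e, y t + b *: e) (conj Us tab).
  by exists s => //; rewrite -E scale0r addr0.
have [r rb Er] : exists2 r : R, `|r| <= `|b| &
    L t (x t) (y t + b *: e) - L t (x t) (y t) =
    gradient (fun v => L t (x t) v) (y t + r *: e) ord0 i * b.
  have x00 d : 0 < d -> `|x t - x t| < d by rewrite subrr normr0.
  have [|r rb E] := @MVT_from0 R (fun r => L t (x t) (y t + r *: e))
    (fun r => gradient (fun v => L t (x t) v) (y t + r *: e) ord0 i) b.
    move=> z zb; rewrite gradientE.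
    apply: (@is_derive_line R V (fun v => L t (x t) v)).
    have [Us _] := H1 t tab _ _ (x00 _ d10) (small _ (y t) _ _ zb b1).
    by have [_ /(_ i)] := hg (t, x t, y t + z *: e) (conj Us tab).
  by exists r => //; rewrite -E scale0r addr0.
have [_ /ltW G1] := H1 t tab _ _ (small _ (x t) _ _ sa a1) (small _ (y t) _ _ (lexx _) b1).
have [|_ /ltW G2] := H2 t tab (x t) _ _ (small _ (y t) _ _ rb b2).
  by rewrite subrr normr0.
rewrite /= in G1 G2.
set gx := gradient _ (x t) ord0 i in G1 *; set gy := gradient _ (y t) ord0 i in G2 *.
set gxs := gradient _ _ ord0 i in G1 Es; set gys := gradient _ _ ord0 i in G2 Er.
rewrite (_ : _ - _ - _ = (gxs - gx) * a + (gys - gy) * b); last first.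
  have -> : L t (x t + a *: e) (y t + b *: e) = gxs * a + (gys * b + L t (x t) (y t)).
    by rewrite -Es -Er; ring.
  by ring.
apply: le_trans (ler_normD _ _) _; rewrite !normrM mulrDr.
by apply: lerD; apply: ler_wpM2r.
Qed.

(** Both endpoint values move at once, so the chain rule goes through the total differential, whose
    values at [(e, 0)] and [(0, e)] are the partial derivatives. *)
Lemma cvg_quotient_bivariate (l : V -> V -> R) (u v : V) (i : 'I_n) (a b : R) :
  differentiable (fun q : V * V => l q.1 q.2) (u, v) ->
  (fun s : R => s^-1 * (l (u + (s * a) *: delta_mx ord0 i) (v + (s * b) *: delta_mx ord0 i)
     - l u v)) @ 0^' -->
  a * gradient (fun w => l w v) u ord0 i + b * gradient (fun w => l u w) v ord0 i.
Proof.
move=> df; set e := delta_mx ord0 i.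
pose f (q : V * V) := l q.1 q.2.
have D w : derivable f (u, v) w by exact: diff_derivable.
have D1 : 'd f (u, v) (e, 0) = gradient (fun w => l w v) u ord0 i.
  have E : (fun h : R => h^-1 *: ((f \o shift (u, v)) (h *: (e, 0)) - f (u, v))) =
      (fun h : R => h^-1 *: (((fun w => l w v) \o shift u) (h *: e) - l u v)).
    by apply/funext => h; rewrite /f /= scaler0 add0r.
  by rewrite -deriveE // gradientE /derive E.
have D2 : 'd f (u, v) (0, e) = gradient (fun w => l u w) v ord0 i.
  have E : (fun h : R => h^-1 *: ((f \o shift (u, v)) (h *: (0, e)) - f (u, v))) =
      (fun h : R => h^-1 *: (((fun w => l u w) \o shift v) (h *: e) - l u v)).
    by apply/funext => h; rewrite /f /= scaler0 add0r.
  by rewrite -deriveE // gradientE /derive E.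
have DE : 'D_(a *: e, b *: e) f (u, v) =
  a * gradient (fun w => l w v) u ord0 i + b * gradient (fun w => l u w) v ord0 i.
  rewrite deriveE // -D1 -D2.
  have -> : (a *: e, b *: e) = a *: (e, 0) + b *: (0, e) :> V * V.
    by congr pair; rewrite /= scaler0 ?addr0 ?add0r.
  by rewrite linearD !linearZ.
rewrite -DE; have := D (a *: e, b *: e).
rewrite /derivable /derive.
rewrite (_ : (fun h : R => h^-1 *: _) = (fun s : R => s^-1 * (l (u + (s * a) *: e) (v + (s * b) *: e)
     - l u v))) //.
by apply/funext => s; rewrite /f /= !scalerA ![_ + u]addrC ![_ + v]addrC.
Qed.

End Expansions.

(** * First variation of the Bolza functional *)

Section FirstVariation.
Context {R : realType} {n : nat}.
Notation V := 'rV[R]_n.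
Notation mu := (@lebesgue_measure R).

Lemma within_continuous_bounded (a b : R) (f : R -> R) :
  {within `[a, b], continuous f} ->
  exists2 M : R, 0 < M & forall t, t \in `[a, b] -> `|f t| <= M.
Proof.
move=> /within_continuous_extension[g [M [_ gM gf]]].
have M0 : 0 <= M by apply: le_trans (gM 0).
exists (M + 1); first by lra.
by move=> t tab; rewrite -gf // (le_trans (gM t)) // lerDl.
Qed.

Lemma within_continuous_scale_delta (a b s : R) (x : R -> V) (f : R -> R) i :
  {within `[a, b], continuous x} -> {within `[a, b], continuous f} ->
  {within `[a, b], continuous (fun t => x t + (s * f t) *: (delta_mx ord0 i : V))}.
Proof.
move=> cx cf; apply: within_continuous_row => j.
have H : {within `[a, b], continuous (fun t => x t ord0 j + s * f t * (j == i)%:R)}.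
  move=> t; apply: cvgD; first exact: within_continuous_coord.
  apply: cvgM; last exact: cvg_cst.
  by apply: cvgM; [exact: cvg_cst|exact: cf].
by apply: subspace_eq_continuous H => t _; rewrite /from_subspace !mxE eqxx.
Qed.

(** The remainder [Er] is at most [eta' * |s| * (H + K)] uniformly in [t], so it can be integrated
    directly against the possibly singular weight, whose mass [W] is finite. *)
Lemma cvg_quotient_integral (t0 t1 q : R) (L : R -> V -> V -> R) (x y : R -> V)
    (U : set (R * V * V)) (i : 'I_n) (h k : R -> R) :
  let A := U `&` [set p | p.1.1 \in `[t0, t1]] in
  t0 <= t1 -> 0 < q ->
  open U -> (forall t, t \in `[t0, t1] -> U (t, x t, y t)) ->
  (forall p, A p -> has_gradient (fun u => L p.1.1 u p.2) p.1.2 /\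
                    has_gradient (fun v => L p.1.1 p.1.2 v) p.2) ->
  {within A, continuous (fun p => L p.1.1 p.1.2 p.2)} ->
  {within A, continuous (fun p => gradient (fun u => L p.1.1 u p.2) p.1.2)} ->
  {within A, continuous (fun p => gradient (fun v => L p.1.1 p.1.2 v) p.2)} ->
  {within `[t0, t1], continuous x} -> {within `[t0, t1], continuous y} ->
  {within `[t0, t1], continuous h} -> {within `[t0, t1], continuous k} ->
  (fun s : R => s^-1 * (\int[mu]_(t in `[t0, t1]) ((t1 - t) `^ (q - 1) *
        L t (x t + (s * h t) *: delta_mx ord0 i) (y t + (s * k t) *: delta_mx ord0 i))
      - \int[mu]_(t in `[t0, t1]) ((t1 - t) `^ (q - 1) * L t (x t) (y t)))) @ 0^' -->
  \int[mu]_(t in `[t0, t1]) ((t1 - t) `^ (q - 1) *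
    (h t * gradient (fun u => L t u (y t)) (x t) ord0 i +
     k t * gradient (fun v => L t (x t) v) (y t) ord0 i)).
Proof.
move=> A t01 q0 oU gU hg cL cLx cLy cx cy ch ck.
set e := delta_mx ord0 i.
pose w t := (t1 - t) `^ (q - 1).
pose gx (t : R) : R := gradient (fun u => L t u (y t)) (x t) ord0 i.
pose gy (t : R) : R := gradient (fun v => L t (x t) v) (y t) ord0 i.
have cgx : {within `[t0, t1], continuous gx}.
  have H := within_continuous_graph (within_continuous_coord (i := i) cLx) cx cy gU.
  exact: H.
have cgy : {within `[t0, t1], continuous gy}.
  have H := within_continuous_graph (within_continuous_coord (i := i) cLy) cx cy gU.
  exact: H.
have iw f : {within `[t0, t1], continuous f} ->
    mu.-integrable `[t0, t1] (fun t => (w t * f t)%:E).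
  exact: integrable_left_kernel_continuous.
have cD : {within `[t0, t1], continuous (fun t => h t * gx t + k t * gy t)}.
  move=> t; apply: cvgD; apply: cvgM.
  - exact: ch.
  - exact: cgx.
  - exact: ck.
  - exact: cgy.
have [H H0 hH] := within_continuous_bounded ch.
have [K K0 kK] := within_continuous_bounded ck.
pose W := \int[mu]_(t in `[t0, t1]) (w t * 1).
have W0 : 0 <= W by apply: Rintegral_ge0 => t _; rewrite mulr1 powR_ge0.
apply/cvgrPdist_le => eta eta0.
(* Chosen so that [eta' * (H + K) * W <= eta]; [W + 1] stays positive even when [t0 = t1] and
   [W = 0]. *)
pose eta' := eta / ((H + K) * (W + 1)).
have HK0 : 0 < H + K by lra.
have W10 : 0 < W + 1 by lra.
have eta'0 : 0 < eta' by rewrite divr_gt0 // mulr_gt0.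
have [d d0 Hd] := graph_expansion i oU gU hg cLx cLy cx cy eta'0.
exists (d / (H + K)); first by rewrite /= divr_gt0.
move=> s /= sd sn0.
rewrite /ball_ /= sub0r normrN ltr_pdivlMr // in sd.
have sh t : t \in `[t0, t1] -> `|s * h t| < d.
  move=> tt; apply: le_lt_trans sd; rewrite normrM; apply: ler_wpM2l => //.
  by apply: le_trans (hH t tt) _; lra.
have sk t : t \in `[t0, t1] -> `|s * k t| < d.
  move=> tt; apply: le_lt_trans sd; rewrite normrM; apply: ler_wpM2l => //.
  by apply: le_trans (kK t tt) _; lra.
pose Ls t := L t (x t + (s * h t) *: e) (y t + (s * k t) *: e).
pose L0 t := L t (x t) (y t).
have cL0 : {within `[t0, t1], continuous L0}.
  have Hc := within_continuous_graph cL cx cy gU.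
  exact: Hc.
have cLs : {within `[t0, t1], continuous Ls}.
  apply: (within_continuous_graph cL).
  - exact: within_continuous_scale_delta.
  - exact: within_continuous_scale_delta.
  - by move=> t tt; have [] := Hd t tt _ _ (sh t tt) (sk t tt).
pose Er t := Ls t - L0 t - s * (h t * gx t + k t * gy t).
have cEr : {within `[t0, t1], continuous Er}.
  move=> t; apply: cvgB; first by apply: cvgB; [exact: cLs|exact: cL0].
  by apply: cvgM; [exact: cvg_cst|exact: cD].
have c1 : {within `[t0, t1], continuous (fun=> 1 : R)}.
  by move=> t; exact: cvg_cst.
have -> : s^-1 * (\int[mu]_(t in `[t0, t1]) (w t * Ls t) -
    \int[mu]_(t in `[t0, t1]) (w t * L0 t)) =
    \int[mu]_(t in `[t0, t1]) (w t * (h t * gx t + k t * gy t)) +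
    s^-1 * \int[mu]_(t in `[t0, t1]) (w t * Er t).
  have E : \int[mu]_(t in `[t0, t1]) (w t * Er t) =
     \int[mu]_(t in `[t0, t1]) (w t * Ls t) - \int[mu]_(t in `[t0, t1]) (w t * L0 t)
     - s * \int[mu]_(t in `[t0, t1]) (w t * (h t * gx t + k t * gy t)).
    rewrite -RintegralB ?iw // -RintegralZl ?iw // -RintegralB //.
    - by apply: eq_Rintegral => t _; rewrite /Er; ring.
    - by apply: (integrableB _ (iw _ cLs) (iw _ cL0)).
    - by apply: (integrableZl _ _ (iw _ cD)).
  by rewrite E; field.
rewrite opprD addrA subrr sub0r normrN normrM normfV.
rewrite ler_pdivrMl ?normr_gt0 //.
apply: le_trans (le_normr_Rintegral _ (iw _ cEr)) _ => //.
apply: (@le_trans _ _ (\int[mu]_(t in `[t0, t1]) (eta' * `|s| * (H + K) * (w t * 1)))).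
  apply: le_Rintegral => //.
  - exact: (integrable_norm (iw _ cEr)).
  - by apply: (integrableZl _ _ (iw _ c1)).
  - move=> t /= tt; rewrite mulr1 normrM ger0_norm ?powR_ge0 // mulrC.
    apply: ler_wpM2r; first exact: powR_ge0.
    have [_] := Hd t tt _ _ (sh t tt) (sk t tt).
    rewrite -/(Ls t) -/(L0 t) -/(gx t) -/(gy t).
    rewrite (_ : s * h t * gx t + s * k t * gy t =
      s * (h t * gx t + k t * gy t)); last by ring.
    move=> h1; apply: le_trans h1 _; rewrite !normrM -mulrDr -[leRHS]mulrA.
    apply: ler_wpM2l; first exact: ltW.
    by apply: ler_wpM2l => //; apply: lerD; [exact: hH|exact: kK].
rewrite RintegralZl ?iw // -/W.
rewrite (_ : eta' * `|s| * (H + K) * W = `|s| * (eta * (W / (W + 1)))); last first.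
  by rewrite /eta'; field; rewrite !gt_eqF.
apply: ler_wpM2l => //; rewrite -[leRHS]mulr1; apply: ler_wpM2l; first exact: ltW.
by rewrite ler_pdivrMr // mul1r; lra.
Qed.

End FirstVariation.

(** * Admissible perturbations of the minimizer *)

Section Variation.
Context {R : realType} {n : nat}.
Notation V := 'rV[R]_n.
Notation mu := (@lebesgue_measure R).

(** For continuous [g] and [0 < a <= 1], the scalar function with initial value [c] and Caputo
    derivative [g]: the general increment of one coordinate inside [C^a]. *)
Definition fractional_primitive (t0 a c : R) (g : R -> R) (t : R) : R :=
  c + (Gamma a)^-1 * \int[mu]_(s in `[t0, t]) ((t - s) `^ (a - 1) * g s).

Lemma fractional_primitive_t0 (t0 a c : R) g : fractional_primitive t0 a c g t0 = c.
Proof. by rewrite /fractional_primitive set_itv1 Rintegral_set1 mulr0 addr0. Qed.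

Lemma within_continuous_fractional_primitive (t0 t1 a c M : R) g : 0 < a ->
  continuous g -> (forall x, `|g x| <= M) ->
  {within `[t0, t1], continuous (fractional_primitive t0 a c g)}.
Proof.
move=> a0 cg gM t; apply: cvgD; first exact: cvg_cst.
apply: cvgM; first exact: cvg_cst.
exact: (within_continuous_left_integral a0 cg gM).
Qed.

Lemma RLleft_scale_delta (t0 t1 a k M : R) (psi : R -> V) (g : R -> R) i t :
  0 < a -> {within `[t0, t1], continuous psi} ->
  continuous g -> (forall x, `|g x| <= M) -> t \in `[t0, t1] ->
  RLleft t0 a (fun s => psi s + (k * g s) *: delta_mx ord0 i) t =
  RLleft t0 a psi t +
  (k * ((Gamma a)^-1 * \int[mu]_(s in `[t0, t]) ((t - s) `^ (a - 1) * g s)))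
    *: delta_mx ord0 i.
Proof.
move=> a0 cpsi cg gM tt; apply/rowP => j; rewrite [in RHS]mxE [X in _ + X]mxE [X in _ * X]mxE.
have an0 : a != 0 by rewrite gt_eqF.
have /andP[t0t tt1] : t0 <= t <= t1 by move: tt; rewrite in_itv.
have mg : measurable_fun [set: R] g by exact: continuous_measurable_fun.
rewrite eqxx /= !RLleftE //.
have ig := integrable_left_kernelM t0t a0 mg gM.
have ip : mu.-integrable `[t0, t] (fun s => ((t - s) `^ (a - 1) * psi s ord0 j)%:E).
  apply: integrable_left_kernel_continuous => //.
  apply: continuous_subspaceW (within_continuous_coord (i := j) cpsi).
  by apply: subset_itvl; rewrite bnd_simp.
rewrite (_ : \int[mu]_(s in `[t0, t]) _ = \int[mu]_(s in `[t0, t])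
   ((t - s) `^ (a - 1) * psi s ord0 j + (k * (j == i)%:R) * ((t - s) `^ (a - 1) * g s))); last first.
  by apply: eq_Rintegral => s _; rewrite !mxE eqxx /=; ring.
rewrite RintegralD //; last by apply: (integrableZl _ _ ig).
by rewrite RintegralZl //; ring.
Qed.

(** The conclusion has the shape of the hypotheses of [CaputoE], so it yields both membership in
    [Calpha] and the Caputo derivative of the perturbed function. *)
Lemma Calpha_scale_delta (t0 t1 a c k M : R) (phi psi : R -> V) (g : R -> R) i :
  t0 < t1 -> 0 < a -> {within `[t0, t1], continuous psi} ->
  (forall t, t \in `[t0, t1] -> phi t = phi t0 + RLleft t0 a psi t) ->
  continuous g -> (forall x, `|g x| <= M) ->
  let phi' := fun t => phi t + (k * fractional_primitive t0 a c g t) *: delta_mx ord0 i in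
  let psi' := fun t => psi t + (k * g t) *: delta_mx ord0 i in
  {within `[t0, t1], continuous psi'} /\
  forall t, t \in `[t0, t1] -> phi' t = phi' t0 + RLleft t0 a psi' t.
Proof.
move=> t01 a0 cpsi phiE cg gM phi' psi'; split.
  by apply: within_continuous_scale_delta => //; exact: continuous_subspaceT.
move=> t tt; rewrite /phi' /psi' (RLleft_scale_delta _ _ a0 cpsi cg gM tt).
rewrite {1}(phiE _ tt) fractional_primitive_t0 /fractional_primitive mulrDr scalerDl.
by rewrite addrACA.
Qed.

Lemma enorm_scale_delta (a : R) i : enorm (a *: (delta_mx ord0 i : V)) = `|a|.
Proof.
rewrite /enorm -sqrtr_sqr; congr Num.sqrt; rewrite (bigD1 i) //= !mxE !eqxx mulr1.
rewrite big1 ?addr0 // => j ji; rewrite !mxE (negPf ji) andbF mulr0 expr0n //.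
Qed.

Lemma sup_le_cst (T : Type) (D : set T) (f : T -> R) (M : R) : D !=set0 ->
  (forall t, D t -> f t <= M) -> sup [set f t | t in D] <= M.
Proof.
move=> [t Dt] H; apply: ge_sup; first by exists (f t), t.
by move=> _ [s Ds <-]; exact: H.
Qed.

Lemma first_variation (t0 t1 alpha beta c M : R)
    (L : R -> V -> V -> R) (l : V -> V -> R) (x0 : R -> V) (g : R -> R) (i : 'I_n) :
  t0 < t1 -> 0 < alpha <= 1 -> 0 < beta ->
  weak_local_min t0 t1 alpha (Bolza t0 t1 alpha beta L l) x0 ->
  smooth_near_graph t0 t1 L x0 (Caputo t0 t1 alpha x0) ->
  differentiable (fun q : V * V => l q.1 q.2) (x0 t0, x0 t1) ->
  continuous g -> (forall x, `|g x| <= M) ->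
  let y0 := Caputo t0 t1 alpha x0 in
  let h := fractional_primitive t0 alpha c g in
  \int[mu]_(t in `[t0, t1]) ((t1 - t) `^ (beta - 1) *
    (h t * gradient (fun u => L t u (y0 t)) (x0 t) ord0 i +
     g t * gradient (fun v => L t (x0 t) v) (y0 t) ord0 i)) +
  (c * gradient (fun u => l u (x0 t1)) (x0 t0) ord0 i +
   h t1 * gradient (fun v => l (x0 t0) v) (x0 t1) ord0 i) = 0.
Proof.
move=> t01 /andP[a0 a1] b0 [Cx0 [delta delta0 hmin]] [U [oU gU hg cL [cLx cLy]]] dl cg gM y0 h.
have a01 : 0 < alpha <= 1 by rewrite a0.
have [psi [cpsi x0E]] := Cx0.
have y0E t : t \in `[t0, t1] -> y0 t = psi t by exact: CaputoE.
have cy0 : {within `[t0, t1], continuous y0}.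
  apply: subspace_eq_continuous cpsi => t; rewrite inE => tt.
  by rewrite /from_subspace y0E.
have cx0 := Calpha_continuous a0 Cx0.
have ch : {within `[t0, t1], continuous h}.
  exact: within_continuous_fractional_primitive.
have cgw : {within `[t0, t1], continuous g} by exact: continuous_subspaceT.
pose e : V := delta_mx ord0 i.
pose xs (s : R) (t : R) := x0 t + (s * h t) *: e.
pose ps (s : R) (t : R) := psi t + (s * g t) *: e.
have Hs s : {within `[t0, t1], continuous (ps s)} /\
    forall t, t \in `[t0, t1] -> xs s t = xs s t0 + RLleft t0 alpha (ps s) t.
  exact: (Calpha_scale_delta c s i t01 a0 cpsi x0E cg gM).
have Cs s t : t \in `[t0, t1] -> Caputo t0 t1 alpha (xs s) t = y0 t + (s * g t) *: e.
  by move=> tt; have [H1 H2] := Hs s; rewrite (CaputoE t01 a01 H1 H2 tt) y0E.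
(* The norm involves the Caputo derivative of the increment itself, which is treated as a
   perturbation of the zero function. *)
have Zs s t : t \in `[t0, t1] -> Caputo t0 t1 alpha (xs s \- x0) t = (s * g t) *: e.
  have c0 : {within `[t0, t1], continuous (fun=> 0 : V)} by move=> r; exact: cvg_cst.
  have E0 r : r \in `[t0, t1] -> 0 = 0 + RLleft t0 alpha (fun=> 0 : V) r.
    move=> _; apply/rowP => j; rewrite add0r RLleftE ?gt_eqF // mxE.
    rewrite [X in _ * X](_ : _ = \int[mu]_(r' in `[t0, r]) 0).
      by rewrite Rintegral_cst // mul0r mulr0.
    by apply: eq_Rintegral => r' _; rewrite mulr0.
  have [H1 H2] := Calpha_scale_delta c s i t01 a0 c0 E0 cg gM.
  move=> tt; rewrite (_ : xs s \- x0 = fun t => 0 + (s * h t) *: e).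
    by rewrite (CaputoE t01 a01 H1 H2 tt) add0r.
  by apply/funext => r; rewrite /xs /= addrAC subrr.
pose Phi (s : R) := \int[mu]_(t in `[t0, t1]) ((t1 - t) `^ (beta - 1) *
   L t (x0 t + (s * h t) *: e) (y0 t + (s * g t) *: e)) + l (xs s t0) (xs s t1).
have PhiE s : Bolza t0 t1 alpha beta L l (xs s) = Phi s.
  rewrite /Bolza /Phi; congr (_ + _); apply: eq_Rintegral => t; rewrite inE => tt.
  by rewrite Cs.
have xs0 : xs 0 = x0 by apply/funext => t; rewrite /xs mul0r scale0r addr0.
have [H H0 hH] := within_continuous_bounded ch.
have M0 : 0 <= M by apply: le_trans (gM 0).
have t0in : `[t0, t1]%classic t0 by rewrite /= in_itv /= lexx ltW.
apply: (@critical_difference_quotient _ Phi); last first.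
  (* [H] and [M] bound [h] and [g], so the increment has [C^alpha] norm at most
     [|s| * (H + M + 1)]. *)
  exists (delta / (H + M + 1)) => /=; first by rewrite divr_gt0 //; lra.
  move=> s; rewrite /ball_ /= sub0r normrN ltr_pdivlMr; last by lra.
  move=> sd; rewrite -!PhiE xs0; apply: hmin.
    by exists (ps s); exact: Hs.
  apply: le_lt_trans sd.
  have -> : `|s| * (H + M + 1) = `|s| * H + `|s| * (M + 1) by ring.
  apply: lerD; apply: sup_le_cst; try by exists t0.
    move=> t tt; rewrite /xs /= addrAC subrr add0r enorm_scale_delta normrM.
    by apply: ler_wpM2l => //; exact: hH.
  move=> t tt; rewrite Zs // enorm_scale_delta normrM; apply: ler_wpM2l => //.
  by apply: le_trans (gM t) _; lra.
have ci := cvg_quotient_integral (i := i) (ltW t01) b0 oU gU hg cL cLx cLy cx0 cy0 ch cgw.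
have cl := cvg_quotient_bivariate (i := i) (a := c) (b := h t1) dl.
have cil := cvgD ci cl.
rewrite (_ : (fun s => s^-1 * (Phi s - Phi 0)) =
  (fun s : R => s^-1 * (\int[mu]_(t in `[t0, t1]) ((t1 - t) `^ (beta - 1) *
     L t (x0 t + (s * h t) *: e) (y0 t + (s * g t) *: e))
     - \int[mu]_(t in `[t0, t1]) ((t1 - t) `^ (beta - 1) * L t (x0 t) (y0 t))) +
   s^-1 * (l (x0 t0 + (s * c) *: e) (x0 t1 + (s * h t1) *: e) - l (x0 t0) (x0 t1)))).
  exact: cil.
apply/funext => s; rewrite /Phi -mulrDr; congr (_ * _).
rewrite /xs /h fractional_primitive_t0 !mul0r !scale0r !addr0.
rewrite -/h -/e.
rewrite (_ : \int[mu]_(t in `[t0, t1]) ((t1 - t) `^ (beta - 1) *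
   L t (x0 t + (0 * h t) *: e) (y0 t + (0 * g t) *: e)) =
   \int[mu]_(t in `[t0, t1]) ((t1 - t) `^ (beta - 1) * L t (x0 t) (y0 t))); last first.
  by apply: eq_Rintegral => t _; rewrite !mul0r !scale0r !addr0.
by ring.
Qed.

End Variation.

(** * Fundamental lemma *)

Section FundamentalLemma.
Context {R : realType}.
Notation mu := (@lebesgue_measure R).
Implicit Types (a b p q M m t s : R) (f g h : R -> R).

(** Factorizations of powers of [b - s] may fail at [s = b], where [powR] has base 0; that point
    carries no mass. *)
Lemma eq_Rintegral_cc_co a b f g : measurable_fun `[a, b[ g ->
  (forall s, a <= s < b -> f s = g s) ->
  \int[mu]_(s in `[a, b]) f s = \int[mu]_(s in `[a, b]) g s.
Proof.
move=> mg fg.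
have mEg : measurable_fun `[a, b[ (EFin \o g) by exact/measurable_EFinP.
have fg' s : s \in `[a, b[%classic -> (g s)%:E = (f s)%:E.
  by rewrite inE /= in_itv /= => sab; rewrite fg.
rewrite /Rintegral -integral_itv_bndo_bndc; last exact: eq_measurable_fun mEg.
rewrite -[in RHS]integral_itv_bndo_bndc //.
by congr fine; apply: eq_integral => s sab; rewrite fg'.
Qed.

(** Nonnegativity squeezes the primitive between 0 and its value at [b], so it vanishes identically,
    and with it the difference quotients, whose limit is [f t] even at the endpoints. *)
Lemma continuous_integral_eq0 a b M f : a < b -> continuous f ->
  (forall x, `|f x| <= M) -> (forall x, 0 <= f x) ->
  \int[mu]_(s in `[a, b]) f s = 0 -> forall t, t \in `[a, b] -> f t = 0.
Proof.
move=> ab cf fM f0 I0 t tab.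
have ii c d : mu.-integrable `[c, d] (EFin \o f).
  by apply: continuous_compact_integrable; [exact: segment_compact|exact: continuous_subspaceT].
have Z s : s \in `[a, b] -> \int[mu]_(x in `[a, s]) f x = 0.
  rewrite in_itv /= => /andP[as_ sb]; apply/eqP; rewrite eq_le Rintegral_ge0 // andbT.
  rewrite -I0 /Rintegral fine_le //; try exact: integrable_fin_num.
  apply: ge0_subset_integral => //.
  - by have /integrableP[] := ii a b.
  - by move=> x _; rewrite lee_fin.
  - by apply: subset_itvl; rewrite bnd_simp.
have PF := within_dnbhs_proper ab tab.
have cv := cvg_difference_quotient_integral ab tab cf fM.
apply/esym; apply: (cvg_unique _ _ cv) => //.
have c0 : (fun=> 0 : R) @ within `[a, b]%classic t^' --> (0 : R) by exact: cvg_cst.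
apply: cvg_trans c0; apply: near_eq_cvg; rewrite near_withinE; near=> s => sab.
by rewrite !Z // subrr mulr0.
Unshelve. all: by end_near. Qed.

(** Since [m <= 1], the weight is at least [(b - a)^(m - 1) > 0] on [[a, b[], so the unweighted
    integral of the square vanishes as well. *)
Lemma weighted_square_eq0 a b m M g : a < b -> 0 < m <= 1 -> continuous g ->
  (forall x, `|g x| <= M) ->
  \int[mu]_(s in `[a, b]) ((b - s) `^ (m - 1) * (g s * g s)) = 0 ->
  forall t, t \in `[a, b] -> g t = 0.
Proof.
move=> ab /andP[m0 m1] cg gM I0.
have cG : continuous (fun s => g s * g s) by move=> x; apply: cvgM; exact: cg.
have GM x : `|g x * g x| <= M * M by rewrite normrM; apply: ler_pM.
have mG : measurable_fun [set: R] (fun s => g s * g s).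
  exact: continuous_measurable_fun.
have G0 x : 0 <= g x * g x by rewrite -expr2 sqr_ge0.
have ba : 0 < b - a by rewrite subr_gt0.
pose w0 := (b - a) `^ (m - 1).
have w00 : 0 < w0 by exact: powR_gt0.
have iG : mu.-integrable `[a, b] (fun s => (g s * g s)%:E).
  by apply: continuous_compact_integrable; [exact: segment_compact|exact: continuous_subspaceT].
have iw0 : mu.-integrable `[a, b] (fun s => (w0 * (g s * g s))%:E).
  by apply: (integrableZl _ _ iG).
have iwG := integrable_left_kernelM (ltW ab) m0 mG GM.
have IG : \int[mu]_(s in `[a, b]) (g s * g s) = 0.
  apply/eqP; rewrite eq_le Rintegral_ge0 // andbT -(pmulr_rle0 _ w00) -RintegralZl //.
  (* The endpoint is dropped because for [m < 1] the weight is 0 there and the lower bound fails. *)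
  rewrite -I0 -!Rintegral_itv_bndo_bndc; last 2 first.
  - by apply: integrableS iwG => //; exact: subset_itv_co_cc.
  - by apply: integrableS iw0 => //; exact: subset_itv_co_cc.
  apply: le_Rintegral => //.
  - by apply: integrableS iw0 => //; exact: subset_itv_co_cc.
  - by apply: integrableS iwG => //; exact: subset_itv_co_cc.
  - move=> s /=; rewrite in_itv /= => /andP[as_ sb]; apply: ler_wpM2r => //.
    rewrite /w0 -(opprK (m - 1)) !(powRN _ (- (m - 1))).
    rewrite lef_pV2 ?posrE ?powR_gt0 ?subr_gt0 //.
    by apply: ge0_ler_powR; rewrite ?nnegrE; lra.
move=> t tab; have := continuous_integral_eq0 ab cG GM G0 IG tab.
by move=> /eqP; rewrite mulf_eq0 orbb => /eqP.
Qed.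

(** Scalar form of the Euler equation, with [p], [q] for [alpha], [beta] and [f], [h] for one
    coordinate of [L_x], [L_y]. Leaving [m] free below both exponents serves the two cases of the
    theorem at once. *)
Lemma euler_from_variation t0 t1 p q m M (l1 : R) f h : t0 < t1 ->
  0 < m <= 1 -> 0 < p -> 0 < q -> m <= p -> m <= q ->
  continuous f -> (forall x, `|f x| <= M) -> {within `[t0, t1], continuous h} ->
  (forall g N, continuous g -> (forall x, `|g x| <= N) ->
    \int[mu]_(t in `[t0, t1]) ((t1 - t) `^ (q - 1) *
      (fractional_primitive t0 p 0 g t * f t + g t * h t)) +
    fractional_primitive t0 p 0 g t1 * l1 = 0) ->
  forall t, t \in `[t0, t1] ->
    (Gamma p)^-1 * ((t1 - t) `^ (p + q - m) * \int[mu]_(u in `[0, 1])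
      (u `^ (p - 1) * (1 - u) `^ (q - 1) * f (t + (t1 - t) * u))) +
    (t1 - t) `^ (q - m) * h t + (Gamma p)^-1 * l1 * (t1 - t) `^ (p - m) = 0.
Proof.
move=> t01 /andP[m0 m1] p0 q0 mp mq cf fM ch var.
set G := (Gamma p)^-1.
set K := fun t => \int[mu]_(u in `[0, 1])
      (u `^ (p - 1) * (1 - u) `^ (q - 1) * f (t + (t1 - t) * u)).
pose H t := G * ((t1 - t) `^ (p + q - m) * K t) + (t1 - t) `^ (q - m) * h t +
   G * l1 * (t1 - t) `^ (p - m).
have cK : continuous K by exact: continuous_beta_integral.
have mf : measurable_fun [set: R] f by exact: continuous_measurable_fun.
have cH1 : {within `[t0, t1], continuous (fun t => G * ((t1 - t) `^ (p + q - m) * K t))}.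
  move=> t; apply: cvgM; first exact: cvg_cst.
  apply: cvgM; last exact: (continuous_subspaceT cK).
  by apply: within_continuous_right_powR; lra.
have cH2 : {within `[t0, t1], continuous (fun t => (t1 - t) `^ (q - m) * h t)}.
  move=> t; apply: cvgM; last exact: ch.
  by apply: within_continuous_right_powR; lra.
have cH3 : {within `[t0, t1], continuous (fun t => G * l1 * (t1 - t) `^ (p - m))}.
  move=> t; apply: cvgM; first exact: cvg_cst.
  by apply: within_continuous_right_powR; lra.
have cH : {within `[t0, t1], continuous H}.
  by move=> t; apply: cvgD; [apply: cvgD; [exact: cH1|exact: cH2]|exact: cH3].
have [g [N [cg gN gH]]] := within_continuous_extension cH.
have mg : measurable_fun [set: R] g by exact: continuous_measurable_fun.
have cgw : {within `[t0, t1], continuous g} by exact: continuous_subspaceT.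
(* Test with (a bounded extension of) the left-hand side itself. *)
suff Z : forall t, t \in `[t0, t1] -> g t = 0 by move=> t tt; rewrite -[LHS]/(H t) -gH // Z.
apply: (@weighted_square_eq0 t0 t1 m N) => //; first by rewrite m0.
have iw (r : R) (k : R -> R) : 0 < r -> {within `[t0, t1], continuous k} ->
    mu.-integrable `[t0, t1] (fun t => ((t1 - t) `^ (r - 1) * k t)%:E).
  by move=> r0; apply: integrable_left_kernel_continuous => //; exact: ltW.
have cM (k1 k2 : R -> R) : {within `[t0, t1], continuous k1} -> {within `[t0, t1], continuous k2} ->
    {within `[t0, t1], continuous (fun t => k1 t * k2 t)}.
  by move=> c1 c2 z; apply: cvgM; [exact: c1|exact: c2].
have mw (k : R -> R) : {within `[t0, t1], continuous k} ->
    measurable_fun `[t0, t1[ (fun t => (t1 - t) `^ (m - 1) * k t).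
  move=> ck; have /integrableP[/measurable_EFinP mk _] := iw m k m0 ck.
  by apply: measurable_funS mk => //; exact: subset_itv_co_cc.
(* Pulls the common weight [(t1 - s)^(m - 1)] out of each kernel. It can fail at [s = t1]: for
   [r = 1] and [m < 1] the left side is [0^0 = 1], the right side 0. *)
have pw r s : m <= r -> t0 <= s < t1 ->
    (t1 - s) `^ (r - 1) = (t1 - s) `^ (m - 1) * (t1 - s) `^ (r - m).
  move=> mr /andP[_ st]; rewrite -powRD; first by congr (_ `^ _); ring.
  by have -> : t1 - s != 0; rewrite ?implybT // subr_eq0 gt_eqF.
pose I1 := \int[mu]_(s in `[t0, t1]) ((t1 - s) `^ (m - 1) *
   (g s * (G * ((t1 - s) `^ (p + q - m) * K s)))).
pose I2 := \int[mu]_(s in `[t0, t1]) ((t1 - s) `^ (m - 1) *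
   (g s * ((t1 - s) `^ (q - m) * h s))).
pose I3 := \int[mu]_(s in `[t0, t1]) ((t1 - s) `^ (m - 1) *
   (g s * (G * l1 * (t1 - s) `^ (p - m)))).
have i1 := iw m _ m0 (cM _ _ cgw cH1).
have i2 := iw m _ m0 (cM _ _ cgw cH2).
have i3 := iw m _ m0 (cM _ _ cgw cH3).
have -> : \int[mu]_(s in `[t0, t1]) ((t1 - s) `^ (m - 1) * (g s * g s)) = I1 + I2 + I3.
  rewrite /I1 /I2 /I3 -RintegralD // -RintegralD //; last by apply: (integrableD _ i1 i2).
  apply: eq_Rintegral => s; rewrite inE /= => ss.
  by rewrite {2}(gH _ ss) /H; ring.
have cF : {within `[t0, t1], continuous (fractional_primitive t0 p 0 g)}.
  exact: within_continuous_fractional_primitive.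
have cfw : {within `[t0, t1], continuous f} by exact: continuous_subspaceT.
rewrite -(var g N cg gN).
have -> : \int[mu]_(t in `[t0, t1]) ((t1 - t) `^ (q - 1) *
      (fractional_primitive t0 p 0 g t * f t + g t * h t)) =
   \int[mu]_(t in `[t0, t1]) ((t1 - t) `^ (q - 1) * (fractional_primitive t0 p 0 g t * f t))
   + \int[mu]_(t in `[t0, t1]) ((t1 - t) `^ (q - 1) * (g t * h t)).
  rewrite -RintegralD //.
  - by apply: eq_Rintegral => t _; rewrite mulrDr.
  - by apply: iw => //; exact: cM.
  - by apply: iw => //; exact: cM.
congr (_ + _ + _).
- pose T := Num.max M N.
  have fT x : `|f x| <= T by rewrite le_max fM.
  have gT x : `|g x| <= T by rewrite le_max gN orbT.
  transitivity (G * \int[mu]_(t in `[t0, t1]) ((t1 - t) `^ (q - 1) * f t *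
    \int[mu]_(s in `[t0, t]) ((t - s) `^ (p - 1) * g s))); last first.
    rewrite -RintegralZl //; last first.
      apply: eq_integrable (iw q _ q0 (cM _ _ cfw
        (within_continuous_left_integral (a := t0) (b := t1) p0 cg gN))) => //.
      by move=> t _; rewrite mulrA.
    by apply: eq_Rintegral => t _; rewrite /fractional_primitive add0r -/G; ring.
  have cPK : {within `[t0, t1], continuous (fun t => (t1 - t) `^ (p + q - m) * K t)}.
    apply: (cM _ _ _ (continuous_subspaceT cK)).
    by apply: within_continuous_right_powR; lra.
  rewrite (triangle_Fubini t0 t1 p0 q0 mf fT mg gT).
  rewrite (@eq_Rintegral_cc_co t0 t1 (fun s => g s * _) (fun s =>
     (t1 - s) `^ (m - 1) * (g s * ((t1 - s) `^ (p + q - m) * K s)))).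
  + rewrite -RintegralZl //; last exact: (iw _ _ m0 (cM _ _ cgw cPK)).
    by apply: eq_Rintegral => s _; ring.
  + exact: (mw _ (cM _ _ cgw cPK)).
  + move=> s ss; have /andP[_ st] := ss.
    rewrite (right_integral01 p0 q0 st mf fM) -/(K s) (pw (p + q)) //; last by lra.
    by ring.
- apply/esym; apply: eq_Rintegral_cc_co; first exact: (mw _ (cM _ _ cgw cH2)).
  by move=> s ss; rewrite (pw q) //; ring.
(* The endpoint term joins the integral because the increment at [t1] is itself an integral of [g]
   against [(t1 - s)^(p - 1)]. *)
- have cP : {within `[t0, t1], continuous (fun t => (t1 - t) `^ (p - m))}.
    by apply: within_continuous_right_powR; lra.
  rewrite /fractional_primitive add0r -/G.
  rewrite (@eq_Rintegral_cc_co t0 t1 (fun s => (t1 - s) `^ (p - 1) * g s) (fun s =>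
     (t1 - s) `^ (m - 1) * (g s * (t1 - s) `^ (p - m)))).
  + rewrite mulrAC -RintegralZl //; last exact: (iw _ _ m0 (cM _ _ cgw cP)).
    by apply: eq_Rintegral => s _; ring.
  + exact: (mw _ (cM _ _ cgw cP)).
  + by move=> s ss; rewrite (pw p) //; ring.
Qed.

End FundamentalLemma.

(** * Euler equation and transversality *)

Section EulerEquation.
Context {R : realType} {n : nat}.
Notation V := 'rV[R]_n.
Notation mu := (@lebesgue_measure R).
Variables (t0 t1 alpha beta : R) (L : R -> V -> V -> R) (l : V -> V -> R) (x0 : R -> V).
Hypotheses (ht : t0 < t1) (halpha : 0 < alpha <= 1) (hbeta : 0 < beta)
  (hmin : weak_local_min t0 t1 alpha (Bolza t0 t1 alpha beta L l) x0)
  (hL : smooth_near_graph t0 t1 L x0 (Caputo t0 t1 alpha x0))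
  (hl : differentiable (fun q : V * V => l q.1 q.2) (x0 t0, x0 t1)).

Let y0 := Caputo t0 t1 alpha x0.
Let Lx t := gradient (fun u => L t u (y0 t)) (x0 t).
Let Ly t := gradient (fun v => L t (x0 t) v) (y0 t).
Let b t := (t1 - t) `^ (beta - 1) *: Lx t.
Let lx0 := gradient (fun u => l u (x0 t1)) (x0 t0).
Let lx1 := gradient (fun v => l (x0 t0) v) (x0 t1).

Lemma within_continuous_Lx_Ly i :
  {within `[t0, t1], continuous (fun t => Lx t ord0 i)} /\
  {within `[t0, t1], continuous (fun t => Ly t ord0 i)}.
Proof.
have /andP[a0 _] := halpha.
have [Cx0 _] := hmin; have [psi [cpsi x0E]] := Cx0.
have cx0 := Calpha_continuous a0 Cx0.
have y0E t : t \in `[t0, t1] -> y0 t = psi t by exact: CaputoE.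
have cy0 : {within `[t0, t1], continuous y0}.
  apply: subspace_eq_continuous cpsi => t; rewrite inE => tt.
  by rewrite /from_subspace y0E.
have [U [oU gU hg cL [cLx cLy]]] := hL.
have H1 := within_continuous_graph (within_continuous_coord (i := i) cLx) cx0 cy0 gU.
have H2 := within_continuous_graph (within_continuous_coord (i := i) cLy) cx0 cy0 gU.
by split; [exact: H1|exact: H2].
Qed.

Lemma transversality : vint `[t0, t1] b + lx0 + lx1 = 0.
Proof.
apply/rowP => i; rewrite !mxE.
have c0 : continuous (fun _ : R => 0 : R) by move=> x; exact: cvg_cst.
have := first_variation 1 i ht halpha hbeta hmin hL hl c0 (M := 0)
  (fun=> ltac:(by rewrite normr0)).
have h1 t : fractional_primitive t0 alpha 1 (fun=> 0) t = 1 :> R.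
  rewrite /fractional_primitive.
  rewrite [X in _ * X](_ : _ = \int[mu]_(s in `[t0, t]) 0).
    by rewrite Rintegral_cst // mul0r mulr0 addr0.
  by apply: eq_Rintegral => s _; rewrite mulr0.
rewrite /= h1 !mul1r -!gradientE -/lx0 -/lx1 addrA => <-; congr (_ + _ + _).
by apply: eq_Rintegral => t _; rewrite h1 mul1r mul0r addr0 mxE.
Qed.

(** [k] is the rescaled integral at [t]. It is kept apart from [RLright] because their relation may
    fail at [t1], where [RLright] is an integral over a point, while the second identity persists
    there and carries the information on [lx1]. *)
Lemma euler_coordinate (m : R) i t : 0 < m -> m <= alpha -> m <= beta -> t \in `[t0, t1] ->
  exists2 k, t < t1 -> RLright t1 alpha b t ord0 i =
      (Gamma alpha)^-1 * ((t1 - t) `^ (alpha + beta - 1) * k) &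
    (Gamma alpha)^-1 * ((t1 - t) `^ (alpha + beta - m) * k) +
    (t1 - t) `^ (beta - m) * Ly t ord0 i +
    (Gamma alpha)^-1 * lx1 ord0 i * (t1 - t) `^ (alpha - m) = 0.
Proof.
move=> m0 ma mb tt; have /andP[a0 a1] := halpha.
have m01 : 0 < m <= 1 by rewrite m0 (le_trans ma).
have [cLx cLy] := within_continuous_Lx_Ly i.
have [f [M [cf fM fLx]]] := within_continuous_extension cLx.
have mf : measurable_fun [set: R] f by exact: continuous_measurable_fun.
exists (\int[mu]_(u in `[0, 1])
      (u `^ (alpha - 1) * (1 - u) `^ (beta - 1) * f (t + (t1 - t) * u))).
  move=> tt1; rewrite RLrightE -(right_integral01 a0 hbeta tt1 mf fM); congr (_ * _).
  apply: eq_Rintegral => s; rewrite inE /= => st; rewrite mxE fLx //.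
  by move: tt st; rewrite !in_itv /= => /andP[tt _] /andP[st ->]; rewrite (le_trans tt st).
apply: (euler_from_variation ht m01 a0 hbeta ma mb cf fM cLy) tt => g N cg gN.
have := first_variation 0 i ht halpha hbeta hmin hL hl cg gN.
rewrite /= mul0r add0r -/lx1 => E; rewrite -[RHS]E; congr (_ + _).
by apply: eq_Rintegral => s; rewrite inE /= => st; rewrite fLx.
Qed.

End EulerEquation.

Theorem theorem4p5 (R : realType) (n : nat) (t0 t1 alpha beta : R)
    (L : R -> 'rV[R]_n -> 'rV[R]_n -> R) (l : 'rV[R]_n -> 'rV[R]_n -> R)
    (x0 : R -> 'rV[R]_n)
    (ht : t0 < t1) (halpha0 : 0 < alpha) (halpha1 : alpha <= 1)
    (hbeta : 0 < beta)
    (hmin : weak_local_min t0 t1 alpha (Bolza t0 t1 alpha beta L l) x0)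
    (hL : smooth_near_graph t0 t1 L x0 (Caputo t0 t1 alpha x0))
    (hl : C1_near l (x0 t0, x0 t1)) :
  let y0 := Caputo t0 t1 alpha x0 in
  let Lx := fun t : R => gradient (fun u => L t u (y0 t)) (x0 t) in
  let Ly := fun t : R => gradient (fun v => L t (x0 t) v) (y0 t) in
  let b := fun t : R => (t1 - t) `^ (beta - 1) *: Lx t in
  let lx0 := gradient (fun u => l u (x0 t1)) (x0 t0) in
  let lx1 := gradient (fun v => l (x0 t0) v) (x0 t1) in
  (alpha < beta ->
    [/\ forall t, t \in `[t0, t1] ->
          (t1 - t) `^ (1 - alpha) *: RLright t1 alpha b t
          + (t1 - t) `^ (beta - alpha) *: Ly t = 0,
        vint `[t0, t1] (fun t => (t1 - t) `^ (beta - 1) *: Lx t) + lx0 = 0 &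
        lx1 = 0]) /\
  (beta <= alpha ->
    (forall t, t \in `[t0, t1] ->
        (t1 - t) `^ (1 - beta) *: RLright t1 alpha b t
        + Ly t
        + ((Gamma alpha)^-1 * (t1 - t) `^ (alpha - beta)) *: lx1 = 0) /\
    vint `[t0, t1] (fun t => (t1 - t) `^ (beta - 1) *: Lx t) + lx0 + lx1 = 0).
Proof.
have halpha : 0 < alpha <= 1 by rewrite halpha0.
have [dl _ _] := nbhs_singleton hl.
move=> y0 Lx Ly b lx0 lx1.
have Tr := transversality ht halpha hbeta hmin hL dl.
have Eu := euler_coordinate ht halpha hbeta hmin hL dl.
have G0 : (Gamma alpha)^-1 != 0 :> R by rewrite invr_eq0 gt_eqF // Gamma_gt0.
have t1in : t1 \in `[t0, t1] by rewrite in_itv /= lexx ltW.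
(* This agrees with the convention that the term containing [I_{t1-}^alpha b] is 0 at [t1]. *)
have RLt1 : RLright t1 alpha b t1 = 0.
  by apply/rowP => i; rewrite RLrightE set_itv1 Rintegral_set1 mulr0 mxE.
have powRDt (t r s : R) : t < t1 ->
    (t1 - t) `^ r * (t1 - t) `^ s = (t1 - t) `^ (r + s).
  by move=> tt; rewrite powRD //; have -> : t1 - t != 0; rewrite ?implybT // subr_eq0 gt_eqF.
split => [ab|ba].
- have l10 : lx1 = 0.
    apply/rowP => i; rewrite [RHS]mxE; apply/eqP.
    have [k _] := Eu alpha i t1 halpha0 (lexx _) (ltW ab) t1in.
    (* With [m = alpha], at [t1] the first two powers have positive exponents and vanish, while the
       last is [0^0 = 1]. *)
    have e1 : alpha + beta - alpha != 0 by rewrite gt_eqF //; lra.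
    have e2 : beta - alpha != 0 by rewrite gt_eqF //; lra.
    rewrite !subrr powRr0 mulr1 (powR0 e1) (powR0 e2).
    rewrite !mul0r mulr0 !add0r => /eqP; rewrite mulf_eq0 (negPf G0) //.
  split => //; last by move: Tr; rewrite -/lx1 l10 addr0.
  move=> t tt; apply/rowP => i.
  rewrite mxE [X in X + _]mxE [X in _ + X]mxE [RHS]mxE.
  have [tt1|] := ltP t t1; last first.
    move=> t1t; have -> : t = t1.
      by apply/eqP; rewrite eq_le t1t andbT; move: tt; rewrite in_itv /= => /andP[].
    have e2 : beta - alpha != 0 by rewrite gt_eqF //; lra.
    by rewrite RLt1 [(0 : 'rV[R]_n) ord0 i]mxE mulr0 subrr (powR0 e2) mul0r addr0.
  have [k RE] := Eu alpha i t halpha0 (lexx _) (ltW ab) tt.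
  rewrite -/lx1 l10 [(0 : 'rV[R]_n) ord0 i]mxE mulr0 mul0r addr0 => E0.
  rewrite (RE tt1) -[RHS]E0; congr (_ + _).
  (* The exponents add up: [(1 - alpha) + (alpha + beta - 1) = beta], which is [alpha + beta - m]
     for [m = alpha]. *)
  rewrite mulrCA [X in _ * X]mulrA powRDt //; congr (_ * (_ `^ _ * _)); ring.
- split => //; move=> t tt; apply/rowP => i.
  rewrite mxE [X in X + _]mxE [X in X + _ + _]mxE [X in _ + X]mxE [RHS]mxE.
  have [k RE E0] := Eu beta i t hbeta ba (lexx _) tt.
  move: E0; rewrite subrr powRr0 mul1r => E0.
  have [tt1|] := ltP t t1; last first.
    move=> t1t; have te : t = t1.
      by apply/eqP; rewrite eq_le t1t andbT; move: tt; rewrite in_itv /= => /andP[].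
    (* At [t1] the term in [k] vanishes because its exponent is [alpha > 0], in agreement with
       [RLright] being 0; the power [alpha - beta] is untouched, so [alpha = beta] keeps its
       [0^0 = 1]. *)
    rewrite te RLt1 [(0 : 'rV[R]_n) ord0 i]mxE mulr0 add0r -te -[RHS]E0 te subrr.
    rewrite (_ : alpha + beta - beta = alpha); last by ring.
    by rewrite [0 `^ alpha]powR0 ?gt_eqF // mul0r mulr0 add0r mulrAC.
  rewrite (RE tt1) -[RHS]E0; congr (_ + _ + _).
    rewrite mulrCA [X in _ * X]mulrA powRDt //; congr (_ * (_ `^ _ * _)); ring.
  by rewrite mulrAC.
Qed.
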